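(* Let $f:\mathbb{N}\to\mathbb{N}$ be any function (the number of candidate samples per step). For every sufficiently large $k$ there exists an instance with $k$ clusters, with a reference clustering of cost $\texttt{OPT}$, such that: (a) for every fixed $\alpha>2$, $D^\alpha$ seeding returns $k$ centers of expected $k$-means cost at most $C_\alpha\cdot\texttt{OPT}$, where $C_\alpha$ depends only on $\alpha$; and (b) the greedy $k$-means++ algorithm with $m=f(k)$ candidates per step returns $k$ centers of expected $k$-means cost $\Omega\big((\log\log f(k))^2\big)\cdot\texttt{OPT}$.
   Context: The $k$-means cost of data $\mathcal{X}$ with centers $Z$ is $\mathrm{cost}^{(2)}(\mathcal{X},Z)=\sum_{x\in\mathcal{X}}\min_{c\in Z}\lVert x-c\rVert^2$. $D^\alpha$ seeding: $z_1$ uniform in $\mathcal{X}$; given current centers $Z_t$ ($t<k$), $z_{t+1}\in\mathcal{X}$ is chosen with probability proportional to $\min_{c\in Z_t}\lVert z-c\rVert^\alpha$. Greedy $k$-means++ with $m$ candidates: $z_1$ uniform in $\mathcal{X}$; given $Z_t$ ($t<k$), $m$ candidates are sampled independently, each with probability proportional to $\min_{c\in Z_t}\lVert z-c\rVert^2$, and the candidate that decreases $\mathrm{cost}^{(2)}(\mathcal{X},\cdot)$ the most is added. An instance may consist of clusters given by probability distributions on $\mathbb{R}^d$ (the limit of infinitely many points), with costs defined by the corresponding integrals. *)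

(* Defs.v *)
From mathcomp Require Export all_boot all_order all_algebra.
From mathcomp Require Export all_classical all_reals all_analysis.

Set Implicit Arguments.
Unset Strict Implicit.
Unset Printing Implicit Defensive.

Import Order.TTheory GRing.Theory Num.Theory.
Import numFieldNormedType.Exports.

Local Open Scope ring_scope.
Local Open Scope ereal_scope.

(* R^d, with the product (Borel) sigma-algebra carried by tuples. *)
Definition euclid (R : realType) (d : nat) := d.-tuple (measurableTypeR R).

Definition edist (R : realType) (d : nat) (x y : euclid R d) : R :=
  Num.sqrt (\sum_(j < d) (tnth x j - tnth y j) ^+ 2)%R.

Definition origin (R : realType) (d : nat) : euclid R d :=
  [tuple (0 : R)%R | j < d].

(* min_{c in Z} ||x - c||^a; the minimum over no centers is +oo. *)
Definition min_dist (R : realType) (d : nat) (a : R) (Z : seq (euclid R d))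
    (x : euclid R d) : \bar R :=
  \big[Order.min/+oo]_(c <- Z) ((edist x c) `^ a)%:E.

Section Instance.
Context (R : realType) (d k : nat).

(* An instance made of k clusters, each a probability distribution on R^d; the
   data is the sum of these k measures. *)
Variable mu : 'I_k -> probability (euclid R d) R.

Definition data_integral (h : euclid R d -> \bar R) : \bar R :=
  \sum_(i < k) \int[mu i]_x h x.

Definition cost (a : R) (Z : seq (euclid R d)) : \bar R :=
  data_integral (min_dist a Z).

Definition centroid (i : 'I_k) : euclid R d :=
  [tuple (\int[mu i]_x (tnth x j : R))%R | j < d].

(* Cost of the reference clustering: each cluster is served by its mean. *)
Definition reference_cost : \bar R :=
  \sum_(i < k) \int[mu i]_x ((edist x (centroid i)) `^ 2)%:E.

(* All moments are finite, so that sampling proportionally to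
   min_{c in Z} ||x - c||^a is meaningful for every a > 0. *)
Definition finite_moments : Prop :=
  forall (i : 'I_k) (p : R), (0 < p)%R ->
    \int[mu i]_x ((edist x (origin R d)) `^ p)%:E < +oo.

(* Expectation of h z, for z drawn from the data with probability proportional
   to w z.  If the total weight is 0, the value is 0 * 0^-1 = 0 * +oo = 0.  This
   only happens below when the centers already cover almost all the data, and
   then 0 is indeed the cost, whatever centers are added. *)
Definition sample (w h : euclid R d -> \bar R) : \bar R :=
  data_integral (fun z => w z * h z) / data_integral w.

(* Expectation of h over the sequence of m independent draws from the law
   whose expectation operator is E. *)
Fixpoint iid_sample (E : (euclid R d -> \bar R) -> \bar R) (m : nat)
    (h : seq (euclid R d) -> \bar R) : \bar R :=
  if m is m'.+1 then E (fun z => iid_sample E m' (fun s => h (z :: s)))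
  else h [::].

(* A step maps the current centers Z and a function h to the expectation of h
   at the next center. *)
Definition Dalpha_step (a : R) (Z : seq (euclid R d))
    (h : euclid R d -> \bar R) : \bar R :=
  sample (min_dist a Z) h.

(* The candidate giving the smallest cost; ties go to the candidate drawn
   first (as the draws are i.i.d., this has the same law as breaking ties
   uniformly at random).  The default origin is only used if cs is empty. *)
Definition best_candidate (Z cs : seq (euclid R d)) : euclid R d :=
  head (origin R d)
    [seq z <- cs | all (fun y => cost 2 (z :: Z) <= cost 2 (y :: Z)) cs].

Definition greedy_step (m : nat) (Z : seq (euclid R d))
    (h : euclid R d -> \bar R) : \bar R :=
  iid_sample (Dalpha_step 2 Z) m (fun cs => h (best_candidate Z cs)).

(* Expected k-means cost after n further steps starting from the centers Z. *)
Fixpoint cost_after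
    (step : seq (euclid R d) -> (euclid R d -> \bar R) -> \bar R)
    (n : nat) (Z : seq (euclid R d)) : \bar R :=
  if n is n'.+1 then step Z (fun z => cost_after step n' (z :: Z))
  else cost 2 Z.

(* First center uniform in the data, then k - 1 steps. *)
Definition seeding_cost
    (step : seq (euclid R d) -> (euclid R d -> \bar R) -> \bar R) : \bar R :=
  sample (fun=> 1) (fun z => cost_after step k.-1 [:: z]).

Definition Dalpha_cost (a : R) : \bar R := seeding_cost (Dalpha_step a).

Definition greedy_cost (m : nat) : \bar R := seeding_cost (greedy_step m).

End Instance.

(* Main.v *)
From HB Require Import structures.
Require Import Defs.
From mathcomp Require Import all_boot all_order all_algebra.
From mathcomp Require Import all_classical all_reals all_analysis measurable_realfun.
From mathcomp Require Import ring lra.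

Set Implicit Arguments.
Unset Strict Implicit.
Unset Printing Implicit Defensive.

Import Order.TTheory GRing.Theory Num.Theory.
Local Open Scope ring_scope.
Local Open Scope ereal_scope.

(* The data lie on a line.  With q = 1/(m+1) for m candidates, cluster 0 is
   (1-q) delta_0 + q delta_1, and each other cluster j is a single point:
   position 2g for cluster 1, and far + g 2^j for j > 1, where g and far/g are
   large.  The reference cost is q(1-q), so a seeding that serves cluster 0 from
   the point 1 loses a factor of order 1/q.

   Greedy: the first center is probably one of the far clusters, which make up
   most of the data.  The m next candidates are then drawn almost uniformly from
   clusters 0 and 1, so the point 1 is among them with constant probability, and
   it is the best candidate, because it is closer to cluster 1 than 0 is.
   Afterwards 0 is so rarely a candidate that every other cluster gets its own
   center, and the final cost is at least 1-q.  The resulting ratio is of order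
   m, which is much more than (log log m)^2.

   D^alpha: the point 1 is the first center in cluster 0 with probability O(q).
   A second center in cluster 0, which leaves another cluster without one, is
   paid for by the geometric spacing: when r+1 clusters are uncovered, one of
   them is at distance at least 2^r, so the expected loss is at most
   (r+1) (2^r)^(2-alpha) times the weight of the other point of cluster 0, and
   these terms are summable. *)

(** * Two-point measures *)

Section TwoPoint.
Local Open Scope classical_set_scope.
Import HBNNSimple.

Lemma measurable_euclid1 (R : realType) (d : nat) (c : euclid R d) :
  measurable [set c].
Proof.
have -> : [set c] = \bigcap_(i in [set: 'I_d])
    ((fun x : euclid R d => tnth x i) @^-1` [set tnth c i]).
  apply/seteqP; split => x /=; first by move=> -> i _.
  by move=> H; apply: eq_from_tnth => i; apply: H.
apply: fin_bigcap_measurable => // i _.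
rewrite -[X in measurable X]setTI; apply: measurable_tnth => //.
Qed.

Context (R : realType) (d : nat) (a b : euclid R d) (q : R).

Definition select (t : bool) : euclid R d := if t then b else a.

Lemma measurable_select : measurable_fun setT select.
Proof. by []. Qed.

HB.instance Definition _ :=
  isMeasurableFun.Build _ _ _ _ select measurable_select.

Definition two_point : probability (euclid R d) R :=
  distribution (bernoulli_prob q) select.

Hypothesis q01 : (0 <= q <= 1)%R.

Lemma measurable_integral_two_point (h : euclid R d -> \bar R) :
  measurable_fun setT h -> (forall x, 0 <= h x) ->
  \int[two_point]_x h x = (1 - q)%:E * h a + q%:E * h b.
Proof.
move=> mh h0.
rewrite ge0_integral_distribution//=.
by rewrite integral_bernoulli_prob//= addeC.
Qed.

Lemma le_integral_two_point (h1 h2 : euclid R d -> \bar R) :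
  (forall x, 0 <= h1 x) -> (forall x, h1 x <= h2 x) ->
  \int[two_point]_x h1 x <= \int[two_point]_x h2 x.
Proof.
move=> h0 h12; rewrite !ge0_integralTE//; last first.
  by move=> x; apply: le_trans (h12 x).
apply: ereal_sup_le => _ [g /= hg <-].
by exists g => // x; apply: le_trans (hg x) (h12 x).
Qed.

(* The Lebesgue integral of the library is a supremum over simple functions
   below [h], so for a finitely supported measure no measurability of [h] is
   needed. *)
Lemma integral_two_point (h : euclid R d -> \bar R) :
  (forall x, 0 <= h x) ->
  \int[two_point]_x h x = (1 - q)%:E * h a + q%:E * h b.
Proof.
have /andP[q0 q1] := q01.
move=> h0; apply/eqP; rewrite eq_le; apply/andP; split.
  rewrite ge0_integralTE//; apply: ge_ereal_sup => _ [g /= hg <-].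
  rewrite -integralT_nnsfun measurable_integral_two_point//.
  - by apply: leeD; apply: lee_pmul; rewrite ?lee_fin ?subr_ge0.
  - by apply/measurable_EFinP.
  - by move=> x; rewrite lee_fin.
(* A measurable minorant of [h] with the same values at [a] and [b] gives the lower bound. *)
pose h' x := if x == a then h a else if x == b then h b else 0.
have mh' : measurable_fun [set: euclid R d] h'.
  have meq c : measurable_fun [set: euclid R d] (fun x => x == c).
    apply: (measurable_fun_bool true); rewrite setTI.
    rewrite (_ : _ @^-1` _ = [set c]); first exact: measurable_euclid1.
    by apply/seteqP; split => x /= /eqP.
  apply: measurable_fun_ifT => //.
  by apply: measurable_fun_ifT.
have -> : (1 - q)%:E * h a + q%:E * h b = \int[two_point]_x h' x.
  rewrite measurable_integral_two_point//; last first.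
    by move=> x; rewrite /h'; case: ifP => // _; case: ifP.
  by rewrite /h' eqxx; case: eqP => [->|_]; rewrite ?eqxx.
apply: le_integral_two_point => x; rewrite /h'.
  by case: ifP => // _; case: ifP.
by case: eqP => [->//|_]; case: eqP => [->|].
Qed.

End TwoPoint.

(** * Reduction to finite sums of reals *)

(* The [edist] of MathComp-Analysis is a different function. *)
Local Notation edist := Defs.edist.

(* [cdist] and [weight] are sealed so that failed unifications do not unfold
   powers of real numbers. *)
HB.lock Definition cdist {R : realType} {d : nat} (Z : seq (euclid R d))
  (x : euclid R d) : R := fine (min_dist 1 Z x).

HB.lock Definition weight {R : realType} {d : nat} (p : R)
  (Z : seq (euclid R d)) (x : euclid R d) : R := (cdist Z x `^ p)%R.

Section CenterDistance.
Context (R : realType) (d : nat).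
Implicit Types (Z : seq (euclid R d)) (x : euclid R d).

Lemma edist_ge0 (x y : euclid R d) : (0 <= edist x y)%R.
Proof. exact: sqrtr_ge0. Qed.

(** One nearest center serves all exponents, because powers with positive exponent are monotone.
    Hence every [min_dist p] is a power of the single function [cdist]. *)
Lemma min_dist_attained Z x : Z != [::] ->
  exists2 c, c \in Z &
    (forall y, y \in Z -> (edist x c <= edist x y)%R) /\
    forall p, (0 < p)%R -> min_dist p Z x = (edist x c `^ p)%:E.
Proof.
elim: Z => // z Z IH _.
have [->|Z0] := eqVneq Z [::].
  exists z; first by rewrite mem_head.
  split; first by move=> y; rewrite inE => /eqP ->.
  by move=> p _; rewrite /min_dist big_seq1.
have [c cZ [cmin cE]] := IH Z0.
have hom p (s t : R) : (0 < p)%R -> (0 <= s <= t)%R -> (s `^ p <= t `^ p)%R.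
  move=> p0 /andP[s0 st]; apply: ge0_ler_powR; rewrite ?nnegrE ?(ltW p0)//.
  exact: le_trans st.
have [le_zc|/ltW le_cz] := leP (edist x z) (edist x c).
  exists z; first exact: mem_head.
  split=> [y|p p0].
    by rewrite inE => /orP[/eqP->//|/cmin]; apply: le_trans.
  rewrite /min_dist big_cons -/(min_dist p Z x) cE//; apply: min_idPl.
  by rewrite lee_fin hom// edist_ge0.
exists c; first by rewrite inE cZ orbT.
split=> [y|p p0]; first by rewrite inE => /orP[/eqP->//|/cmin].
rewrite /min_dist big_cons -/(min_dist p Z x) cE//; apply: min_idPr.
by rewrite lee_fin hom// edist_ge0.
Qed.

Lemma cdist_attained Z x : Z != [::] ->
  exists2 c, c \in Z & cdist Z x = edist x c.
Proof.
move=> /(min_dist_attained x)[c cZ [_ cE]]; exists c => //.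
by rewrite cdist.unlock cE//= powRr1// edist_ge0.
Qed.

Lemma min_distE p Z x : (0 < p)%R -> Z != [::] ->
  min_dist p Z x = (weight p Z x)%:E.
Proof.
move=> p0 /(min_dist_attained x)[c cZ [_ cE]].
by rewrite weight.unlock cdist.unlock !cE//= powRr1// edist_ge0.
Qed.

Lemma cdist_ge0 Z x : (0 <= cdist Z x)%R.
Proof.
have [->|/(@cdist_attained _ x)[c _ ->]] := eqVneq Z [::]; last exact: edist_ge0.
(* Without centers the minimum is [+oo], which [fine] sends to 0. *)
by rewrite cdist.unlock /min_dist big_nil.
Qed.

Lemma cdist_le Z x c : c \in Z -> (cdist Z x <= edist x c)%R.
Proof.
move=> cZ; have Z0 : Z != [::] by case: Z cZ.
have [c' c'Z [cmin cE]] := min_dist_attained x Z0.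
by rewrite cdist.unlock cE//= powRr1 ?edist_ge0 ?cmin.
Qed.

Lemma cdist_ge Z x r : Z != [::] ->
  (forall c, c \in Z -> (r <= edist x c)%R) -> (r <= cdist Z x)%R.
Proof. by move=> /(@cdist_attained _ x)[c cZ ->]; apply. Qed.

Lemma cdist_cons Z x z : Z != [::] -> (cdist (z :: Z) x <= cdist Z x)%R.
Proof.
move=> /(@cdist_attained _ x)[c cZ ->].
by apply: cdist_le; rewrite inE cZ orbT.
Qed.

Lemma edistxx x : edist x x = 0%R.
Proof. by rewrite /edist big1 ?sqrtr0// => j _; rewrite subrr expr0n. Qed.

Lemma cdist_mem Z x : x \in Z -> cdist Z x = 0%R.
Proof.
move=> xZ; apply/eqP; rewrite eq_le cdist_ge0 andbT.
by rewrite -(edistxx x) cdist_le.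
Qed.

Lemma edistC x y : edist x y = edist y x.
Proof.
by rewrite /edist; congr Num.sqrt; apply: eq_bigr => j _; rewrite -sqrrN opprB.
Qed.

Lemma weight_ge0 p Z x : (0 <= weight p Z x)%R.
Proof. by rewrite weight.unlock powR_ge0. Qed.

Lemma weight_mem p Z x : (0 < p)%R -> x \in Z -> weight p Z x = 0%R.
Proof.
by move=> p0 xZ; rewrite weight.unlock cdist_mem// powR0// gt_eqF.
Qed.

Lemma weight2 Z x : weight 2 Z x = (cdist Z x ^+ 2)%R.
Proof. by rewrite weight.unlock powR_mulrn// cdist_ge0. Qed.

Lemma le_weight p Z x y : (0 < p)%R -> (cdist Z x <= cdist Z y)%R ->
  (weight p Z x <= weight p Z y)%R.
Proof.
move=> p0 xy; rewrite weight.unlock.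
by apply: ge0_ler_powR; rewrite ?nnegrE ?cdist_ge0// ltW.
Qed.

Lemma weight_le1 p Z x : (0 < p)%R -> (cdist Z x <= 1)%R -> (weight p Z x <= 1)%R.
Proof.
move=> p0 x1; rewrite weight.unlock; apply: (@le_trans _ _ (1 `^ p)%R).
  by apply: ge0_ler_powR; rewrite ?nnegrE ?cdist_ge0// ltW.
by rewrite powR1.
Qed.

End CenterDistance.

Section TwoPointInstance.
Context (R : realType) (d k : nat) (a b : 'I_k -> euclid R d) (q : R).
Hypothesis q01 : (0 <= q <= 1)%R.
Implicit Types (Z : seq (euclid R d)) (x : euclid R d).

Definition clusters (i : 'I_k) : probability (euclid R d) R :=
  two_point (a i) (b i) q.

Definition wsum (h : euclid R d -> R) : R :=
  (\sum_(i < k) ((1 - q) * h (a i) + q * h (b i)))%R.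

Lemma data_integralE (h : euclid R d -> R) : (forall x, 0 <= h x)%R ->
  data_integral clusters (EFin \o h) = (wsum h)%:E.
Proof.
move=> h0; rewrite /data_integral /wsum -sumEFin; apply: eq_bigr => i _.
by rewrite integral_two_point// => x; rewrite lee_fin.
Qed.

Lemma wsum_ge0 (h : euclid R d -> R) : (forall x, 0 <= h x)%R -> (0 <= wsum h)%R.
Proof.
have /andP[q0 q1] := q01.
by move=> h0; apply: sumr_ge0 => i _; rewrite addr_ge0 ?mulr_ge0 ?subr_ge0.
Qed.

Definition rsample (w h : euclid R d -> R) : R :=
  (wsum (fun x => w x * h x) / wsum w)%R.

Lemma rsample_ge0 (w h : euclid R d -> R) :
  (forall x, 0 <= w x)%R -> (forall x, 0 <= h x)%R -> (0 <= rsample w h)%R.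
Proof.
by move=> w0 h0; rewrite divr_ge0 ?wsum_ge0// => x; rewrite mulr_ge0.
Qed.

(** The delicate case is total weight 0: the inverse of 0 is [+oo] on the left and 0 on the right.
    Both sides still vanish, since nonnegative weights that sum to 0 annihilate the numerator. *)
Lemma sampleE (w h : euclid R d -> R) :
  (forall x, 0 <= w x)%R -> (forall x, 0 <= h x)%R ->
  sample clusters (EFin \o w) (EFin \o h) = (rsample w h)%:E.
Proof.
move=> w0 h0; rewrite /sample /rsample data_integralE//.
rewrite (_ : (fun z => _) = EFin \o (fun x => w x * h x)%R); last first.
  by apply/funext => z /=; rewrite EFinM.
rewrite data_integralE; last by move=> x; rewrite mulr_ge0.
have [w_eq0|w_neq0] := eqVneq (wsum w) 0%R; last by rewrite inver (negbTE w_neq0).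
rewrite w_eq0 invr0 mulr0 (_ : wsum _ = 0%R) ?mul0e//.
have /andP[q0 q1] := q01.
have q1' : (0 <= 1 - q)%R by rewrite subr_ge0.
apply: big1 => i _.
have ge0 (j : 'I_k) : true -> (0 <= (1 - q) * w (a j) + q * w (b j))%R.
  by move=> _; rewrite addr_ge0 ?mulr_ge0.
have /eqP := @psumr_eq0P _ _ _ _ ge0 w_eq0 i isT.
rewrite paddr_eq0 ?mulr_ge0// => /andP[/eqP wa /eqP wb].
by rewrite !mulrA wa wb !mul0r addr0.
Qed.

Definition rstep (p : R) Z (h : euclid R d -> R) : R :=
  rsample (weight p Z) h.

Lemma rstep_ge0 p Z (h : euclid R d -> R) :
  (forall x, 0 <= h x)%R -> (0 <= rstep p Z h)%R.
Proof. by move=> h0; apply: rsample_ge0 => // x; apply: weight_ge0. Qed.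

Lemma Dalpha_stepE p Z (h : euclid R d -> R) : (0 < p)%R -> Z != [::] ->
  (forall x, 0 <= h x)%R ->
  Dalpha_step clusters p Z (EFin \o h) = (rstep p Z h)%:E.
Proof.
move=> p0 Z0 h0; rewrite /Dalpha_step -sampleE//; last first.
  by move=> x; apply: weight_ge0.
by congr sample; apply/funext => x /=; rewrite min_distE.
Qed.

Definition rcost Z : R := wsum (fun x => cdist Z x ^+ 2)%R.

Lemma rcost_ge0 Z : (0 <= rcost Z)%R.
Proof. by apply: wsum_ge0 => x; rewrite sqr_ge0. Qed.

Lemma costE Z : Z != [::] -> cost clusters 2 Z = (rcost Z)%:E.
Proof.
move=> Z0; rewrite /cost -data_integralE; last by move=> x; rewrite sqr_ge0.
congr data_integral; apply/funext => x /=.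
by rewrite min_distE// weight2.
Qed.

Fixpoint riid (E : (euclid R d -> R) -> R) (m : nat)
    (h : seq (euclid R d) -> R) : R :=
  if m is m'.+1 then E (fun z => riid E m' (fun s => h (z :: s))) else h [::].

Lemma riid_ge0 (E : (euclid R d -> R) -> R) m h :
  (forall g, (forall x, 0 <= g x)%R -> (0 <= E g)%R) ->
  (forall s, 0 <= h s)%R -> (0 <= riid E m h)%R.
Proof.
move=> E0; elim: m h => [|m IH] h h0 /=; first exact: h0.
by apply: E0 => x; apply: IH.
Qed.

Definition rgreedy (m : nat) Z (h : euclid R d -> R) : R :=
  riid (rstep 2 Z) m (fun cs => h (best_candidate clusters Z cs)).

Lemma iid_sampleE p Z m (h : seq (euclid R d) -> R) : (0 < p)%R -> Z != [::] ->
  (forall s, 0 <= h s)%R ->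
  iid_sample (Dalpha_step clusters p Z) m (EFin \o h)
    = (riid (rstep p Z) m h)%:E.
Proof.
move=> p0 Z0; elim: m h => [//|m IH] h h0 /=.
rewrite -Dalpha_stepE//; last first.
  by move=> x; apply: riid_ge0 => // g g0; apply: rstep_ge0.
by congr Dalpha_step; apply/funext => z /=; rewrite -IH.
Qed.

Fixpoint rcost_after (step : seq (euclid R d) -> (euclid R d -> R) -> R)
    (n : nat) Z : R :=
  if n is n'.+1 then step Z (fun z => rcost_after step n' (z :: Z))
  else rcost Z.

Lemma rcost_after_ge0 step n Z :
  (forall Y g, (forall x, 0 <= g x)%R -> (0 <= step Y g)%R) ->
  (0 <= rcost_after step n Z)%R.
Proof.
move=> step0; elim: n Z => [|n IH] Z /=; first exact: rcost_ge0.
by apply: step0 => x; apply: IH.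
Qed.

Lemma rgreedy_ge0 m Z (h : euclid R d -> R) :
  (forall x, 0 <= h x)%R -> (0 <= rgreedy m Z h)%R.
Proof. by move=> h0; apply: riid_ge0 => // g g0; apply: rstep_ge0. Qed.

(** Over no centers the extended cost is infinite and has no real counterpart, hence the restriction
    to nonempty lists. It persists because every step prepends a center. *)
Lemma cost_afterE step rs n Z :
  (forall Y h, Y != [::] -> (forall x, 0 <= h x)%R ->
     step Y (EFin \o h) = (rs Y h)%:E) ->
  (forall Y g, (forall x, 0 <= g x)%R -> (0 <= rs Y g)%R) ->
  Z != [::] ->
  cost_after clusters step n Z = (rcost_after rs n Z)%:E.
Proof.
move=> stepE rs0; elim: n Z => [|n IH] Z Z0 /=; first exact: costE.
rewrite -stepE//; last by move=> x; apply: rcost_after_ge0.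
by congr step; apply/funext => z /=; rewrite IH.
Qed.

Lemma seeding_costE step rs :
  (forall Y h, Y != [::] -> (forall x, 0 <= h x)%R ->
     step Y (EFin \o h) = (rs Y h)%:E) ->
  (forall Y g, (forall x, 0 <= g x)%R -> (0 <= rs Y g)%R) ->
  seeding_cost clusters step =
    (rsample (fun=> 1%R) (fun z => rcost_after rs k.-1 [:: z]))%:E.
Proof.
move=> stepE rs0; rewrite /seeding_cost -sampleE//; last first.
  by move=> x; apply: rcost_after_ge0.
by congr sample; apply/funext => z /=; rewrite (cost_afterE _ stepE).
Qed.

Lemma Dalpha_costE p : (0 < p)%R ->
  Dalpha_cost clusters p =
    (rsample (fun=> 1%R) (fun z => rcost_after (rstep p) k.-1 [:: z]))%:E.
Proof.
move=> p0; apply: seeding_costE => [Y h Y0 h0|Y g g0]; last exact: rstep_ge0.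
exact: Dalpha_stepE.
Qed.

Lemma greedy_costE m :
  greedy_cost clusters m =
    (rsample (fun=> 1%R) (fun z => rcost_after (rgreedy m) k.-1 [:: z]))%:E.
Proof.
apply: seeding_costE => [Y h Y0 h0|Y g g0]; last exact: rgreedy_ge0.
by rewrite /greedy_step /rgreedy -iid_sampleE.
Qed.

Lemma finite_moments_two_point : finite_moments clusters.
Proof.
move=> i p p0; rewrite integral_two_point//; last first.
  by move=> x; rewrite lee_fin powR_ge0.
by rewrite -!EFinM -EFinD ltry.
Qed.

(** Each summand is the variance of a two-point law, computed coordinate by coordinate. Nonnegative
    coordinates make the negative part vanish in the integral that defines the centroid. *)
Lemma reference_costE : (forall i j, 0 <= tnth (a i) j)%R ->
  (forall i j, 0 <= tnth (b i) j)%R ->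
  reference_cost clusters =
  (\sum_(i < k) (q * (1 - q) * edist (a i) (b i) ^+ 2)%R%:E).
Proof.
move=> a0 b0; apply: eq_bigr => i _.
have cE j : tnth (centroid clusters i) j =
    ((1 - q) * tnth (a i) j + q * tnth (b i) j)%R.
  rewrite tnth_mktuple /Rintegral integralE !integral_two_point//.
  rewrite !funeposE !funenegE /=. rewrite -!EFin_max -!EFinM -!EFinD /=.
  have maxl (t : R) : (0 <= t)%R -> Num.max t 0%R = t by move=> ?; apply/max_idPl.
  have maxr (t : R) : (0 <= t)%R -> Num.max (- t)%R 0%R = 0%R.
    by move=> ?; apply/max_idPr; rewrite oppr_le0.
  rewrite (maxl _ (a0 i j)) (maxl _ (b0 i j)).
  by rewrite (maxr _ (a0 i j)) (maxr _ (b0 i j)) !mulr0 addr0 subr0.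
rewrite integral_two_point//; last by move=> x; rewrite lee_fin powR_ge0.
rewrite -!EFinM -EFinD; congr EFin.
rewrite !powR_mulrn ?edist_ge0// /edist !sqr_sqrtr; try by
  apply: sumr_ge0 => j _; rewrite sqr_ge0.
rewrite !mulr_sumr -big_split; apply: eq_bigr => j _ /=.
by rewrite cE; ring.
Qed.

End TwoPointInstance.

(** * Sampling and candidate selection *)

Section RealSampling.
Context (R : realType) (d k : nat) (a b : 'I_k -> euclid R d) (q : R).
Hypothesis q01 : (0 <= q <= 1)%R.
Local Open Scope ring_scope.
Local Notation wsum := (wsum a b q).
Local Notation rsample := (rsample a b q).
Local Notation riid := (@riid R d).
Implicit Types (w h : euclid R d -> R) (G : pred (euclid R d)).

Lemma le_wsum h1 h2 :
  (forall i, h1 (a i) <= h2 (a i)) -> (forall i, h1 (b i) <= h2 (b i)) ->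
  wsum h1 <= wsum h2.
Proof.
have /andP[q0 q1] := q01.
move=> ha hb; apply: ler_sum => i _.
by apply: lerD; apply: ler_wpM2l; rewrite ?subr_ge0.
Qed.

Lemma wsumZr h c : wsum (fun x => h x * c) = wsum h * c.
Proof. by rewrite /wsum mulr_suml; apply: eq_bigr => i _; ring. Qed.

Lemma wsumD h1 h2 : wsum (fun x => h1 x + h2 x) = wsum h1 + wsum h2.
Proof. by rewrite /wsum -big_split; apply: eq_bigr => i _ /=; ring. Qed.

Lemma rsample_le w h M : (forall x, 0 <= w x) -> 0 <= M ->
  wsum (fun x => w x * h x) <= M * wsum w -> rsample w h <= M.
Proof.
move=> w0 M0 H; rewrite /rsample.
have : 0 <= wsum w by apply: wsum_ge0.
rewrite le_eqVlt => /orP[/eqP <-|W0]; first by rewrite invr0 mulr0.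
by rewrite ler_pdivrMr.
Qed.

Lemma rsample_ge w h M : 0 < wsum w ->
  M * wsum w <= wsum (fun x => w x * h x) -> M <= rsample w h.
Proof. by move=> W0 H; rewrite /rsample ler_pdivlMr. Qed.

(** Each draw lands in [G] with probability at least [g], so by independence all [m] draws do with
    probability at least [g ^+ m]. *)
Lemma riid_all_ge w G (g v : R) m (h : seq (euclid R d) -> R) :
  (forall x, 0 <= w x) -> 0 < wsum w ->
  0 <= v -> 0 <= g ->
  g * wsum w <= wsum (fun x => w x * (G x)%:R) ->
  (forall s, 0 <= h s) ->
  (forall s, size s = m -> all G s -> v <= h s) ->
  g ^+ m * v <= riid (rsample w) m h.
Proof.
move=> w0 W0 v0 g0 gW; elim: m h => [|m IH] h h0 hv /=.
  by rewrite expr0 mul1r hv.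
apply: rsample_ge => //.
have E0 f : (forall x, 0 <= f x) -> 0 <= rsample w f by apply: rsample_ge0.
apply: (@le_trans _ _ (wsum (fun x => w x * (G x)%:R * (g ^+ m * v)))).
  rewrite wsumZr (_ : _ * v * _ = g * wsum w * (g ^+ m * v)); last first.
    by rewrite exprS; ring.
  by apply: ler_wpM2r => //; rewrite mulr_ge0// exprn_ge0.
have H z : w z * (G z)%:R * (g ^+ m * v) <=
    w z * riid (rsample w) m (fun s => h (z :: s)).
  rewrite -mulrA ler_wpM2l//; case: (boolP (G z)) => Gz.
    rewrite mul1r; apply: IH => // s sm Gs.
    by apply: hv; rewrite /= ?sm// Gz.
  by rewrite mul0r riid_ge0.
by apply: le_wsum => i; apply: H.
Qed.

(** Draws lie in [G] almost surely, and all [m] of them miss [o] with probability at most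
    [(1 - p) ^+ m]. *)
Lemma riid_some_ge w G o (p v : R) m (h : seq (euclid R d) -> R) :
  (forall x, 0 <= w x) -> 0 < wsum w ->
  0 <= v -> 0 <= p <= 1 -> G o ->
  wsum w <= wsum (fun x => w x * (G x)%:R) ->
  p * wsum w <= wsum (fun x => w x * (x == o)%:R) ->
  (forall s, 0 <= h s) ->
  (forall s, size s = m -> all G s -> o \in s -> v <= h s) ->
  (1 - (1 - p) ^+ m) * v <= riid (rsample w) m h.
Proof.
move=> w0 W0 v0 /andP[p0 p1] Go GW pW; elim: m h => [|m IH] h h0 hv /=.
  by rewrite expr0 subrr mul0r.
apply: rsample_ge => //.
set t := 1 - (1 - p) ^+ m.
have pm : 0 <= (1 - p) ^+ m <= 1.
  by rewrite exprn_ge0 ?subr_ge0//= exprn_ile1 ?subr_ge0// gerBl.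
have /andP[t0 t1] : 0 <= t <= 1.
  by case/andP: pm => ? ?; rewrite /t subr_ge0 gerBl; apply/andP.
have E0 f : (forall x, 0 <= f x) -> 0 <= rsample w f by apply: rsample_ge0.
(* Any first draw in [G] guarantees [t * v] by induction. The draw [o] already settles the event and
   so adds the missing [(1 - t) * v]. *)
apply: (@le_trans _ _ (wsum (fun x => w x * (G x)%:R * (t * v) +
    w x * (x == o)%:R * ((1 - t) * v)))).
  rewrite wsumD !wsumZr.
  have -> : (1 - (1 - p) ^+ m.+1) * v * wsum w =
      wsum w * (t * v) + p * wsum w * ((1 - t) * v).
    by rewrite /t exprS; ring.
  by apply: lerD; apply: ler_wpM2r => //; rewrite mulr_ge0// subr_ge0.
have H z : w z * (G z)%:R * (t * v) + w z * (z == o)%:R * ((1 - t) * v) <=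
    w z * riid (rsample w) m (fun s => h (z :: s)).
  rewrite -!mulrA -mulrDr ler_wpM2l//.
  have [->|zo] := eqVneq z o.
    rewrite Go !mulr1n (_ : _ + _ = 1 ^+ m * v); last by rewrite expr1n /t; ring.
    apply: (@riid_all_ge _ G) => //; first by rewrite mul1r.
    by move=> s sm Gs; apply: hv; rewrite /= ?sm ?Go ?mem_head.
  rewrite mul0r addr0; case: (boolP (G z)) => Gz; last by rewrite mul0r riid_ge0.
  rewrite mul1r; apply: IH => // s sm Gs os.
  by apply: hv; rewrite /= ?sm ?Gz// inE os orbT.
by apply: le_wsum => i; apply: H.
Qed.

End RealSampling.

(** The constant 3 works because [Y <= X <= 2 * (1 - q) * X] for [q] at most one half. Here [X] and
    [Y] stand for the weights of the main point and the outlier of the base cluster, and [W] for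
    that of the other clusters. *)
Lemma base_uncovered_arith (R : realType) (q K X Y W : R) :
  (0 <= q <= 2^-1 -> 0 <= K -> 0 <= Y <= X ->
  (1 - q) * (X * (q * K)) + q * (Y * K) + W * (3 * q * K) <=
  3 * q * K * ((1 - q) * X + q * Y + W))%R.
Proof.
move=> /andP[q0 q2] K0 /andP[Y0 YX].
have -> : ((1 - q) * (X * (q * K)) + q * (Y * K) + W * (3 * q * K) =
  q * K * ((1 - q) * X + Y + 3 * W))%R by ring.
have -> : (3 * q * K * ((1 - q) * X + q * Y + W) =
  q * K * (3 * ((1 - q) * X) + 3 * (q * Y) + 3 * W))%R by ring.
apply: ler_wpM2l; first by rewrite mulr_ge0.
have qY : (0 <= q * Y)%R by rewrite mulr_ge0.
have : (q * X <= 2^-1 * X)%R by rewrite ler_wpM2r//; lra.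
by rewrite mulrBl mul1r; lra.
Qed.

Section BestCandidate.
Context (R : realType) (d k : nat) (mu : 'I_k -> probability (euclid R d) R).
Implicit Types (Z cs : seq (euclid R d)).

Lemma best_candidate_min Z cs : cs != [::] ->
  best_candidate mu Z cs \in cs /\
  all (fun y => cost mu 2 (best_candidate mu Z cs :: Z) <= cost mu 2 (y :: Z)) cs.
Proof.
move=> cs0.
set P := fun z => all (fun y => cost mu 2 (z :: Z) <= cost mu 2 (y :: Z)) cs.
have /hasP[z zcs Pz] : has P cs.
  rewrite {}/P; elim: cs cs0 => // z cs IH _.
  have [->|/IH/hasP[y ycs ymin]] := eqVneq cs [::]; first by rewrite /= lexx.
  have [yz|/ltW zy] := leP (cost mu 2 (y :: Z)) (cost mu 2 (z :: Z)).
    by apply/hasP; exists y; rewrite ?inE ?ycs ?orbT//= yz.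
  apply/hasP; exists z; rewrite ?mem_head//= lexx /=.
  by apply/allP => x xcs; apply: le_trans zy (allP ymin x xcs).
have : best_candidate mu Z cs \in [seq z <- cs | P z].
  rewrite /best_candidate -/P; have : z \in [seq z <- cs | P z].
    by rewrite mem_filter Pz.
  by case: [seq z <- cs | P z] => // y s _; exact: mem_head.
by rewrite mem_filter => /andP[].
Qed.

(** A strict inequality makes the tie-breaking rule irrelevant. *)
Lemma best_candidate_unique Z cs o : o \in cs ->
  (forall y, y \in cs -> y != o -> cost mu 2 (o :: Z) < cost mu 2 (y :: Z)) ->
  best_candidate mu Z cs = o.
Proof.
move=> ocs lt_o; have cs0 : cs != [::] by case: cs ocs {lt_o}.
have [bcs /allP/(_ _ ocs)] := best_candidate_min Z cs0.
have [->//|bo] := eqVneq (best_candidate mu Z cs) o.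
by rewrite leNgt lt_o.
Qed.

End BestCandidate.

(** * Well separated clusters *)

Section SeparatedClusters.
Context (R : realType) (d n : nat) (a b : 'I_n.+1 -> euclid R d) (q g : R).
Local Open Scope ring_scope.
Implicit Types (i j : 'I_n.+1) (Z : seq (euclid R d)) (z : euclid R d).
Hypotheses (q_gt0 : 0 < q) (q_le : q <= 2^-1) (g_ge1 : 1 <= g).
Hypothesis ab : forall j, j != ord0 -> b j = a j.
Hypothesis base_dist : edist (a ord0) (b ord0) = 1.
Hypothesis separated : forall i j z, j != ord0 -> i != j ->
  z \in [:: a i; b i] -> g * 2 ^+ j.-1 <= edist (a j) z.
Local Notation wsum := (wsum a b q).
Local Notation rcost := (rcost a b q).
Local Notation rstep := (rstep a b q).

Let q01 : 0 <= q <= 1.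
Proof. by move: q_gt0 q_le => ? ?; apply/andP; split; lra. Qed.

(** A common point of two clusters would be at distance 0 from itself, against the positive
    separation. *)
Lemma atom_cluster_inj i j z : z \in [:: a i; b i] -> z \in [:: a j; b j] -> i = j.
Proof.
wlog j0 : i j / j != ord0 => [H zi zj|zi zj].
  have [j0|j0] := eqVneq j ord0; last exact: H.
  have [i0|i0] := eqVneq i ord0; first by rewrite i0 j0.
  by apply/esym/H.
apply/eqP/negPn/negP => ij.
have := separated j0 ij zi; move: zj; rewrite ab// !inE orbb => /eqP ->.
rewrite edistxx leNgt mulr_gt0 ?exprn_gt0//; exact: lt_le_trans g_ge1.
Qed.

Definition atom z := [exists i, z \in [:: a i; b i]].

Lemma atom_a i : atom (a i).
Proof. by apply/existsP; exists i; rewrite mem_head. Qed.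

Lemma atom_b i : atom (b i).
Proof. by apply/existsP; exists i; rewrite !inE eqxx orbT. Qed.

Definition uncovered Z : {set 'I_n.+1} := [set i | (a i \notin Z) && (b i \notin Z)].

Lemma uncovered_nil : uncovered [::] = [set: 'I_n.+1]%SET.
Proof. by apply/setP => j; rewrite !inE. Qed.

Lemma uncovered_cons Z i z : z \in [:: a i; b i] ->
  uncovered (z :: Z) = uncovered Z :\ i.
Proof.
move=> zi; apply/setP => j; rewrite !inE !negb_or.
have [->|ji] /= := eqVneq j i.
  move: zi; rewrite !inE => /orP[]/eqP ->; first by rewrite eqxx.
  by rewrite eqxx !andbF.
have -> : a j != z.
  apply: contra ji => /eqP ajz; apply/eqP; apply: atom_cluster_inj zi.
  by rewrite -ajz mem_head.
suff -> : b j != z by [].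
apply: contra ji => /eqP bjz; apply/eqP; apply: atom_cluster_inj zi.
by rewrite -bjz !inE eqxx orbT.
Qed.

Lemma card_uncovered_cons Z i z : z \in [:: a i; b i] -> i \in uncovered Z ->
  #|uncovered Z| = #|uncovered (z :: Z)|.+1.
Proof. by move=> zi iU; rewrite (uncovered_cons _ zi) (cardsD1 i) iU. Qed.

Lemma covered_mem Z j : j != ord0 -> j \notin uncovered Z -> a j \in Z.
Proof. by move=> j0; rewrite !inE ab// andbb negbK. Qed.

Lemma wsum_split h : wsum h =
  (1 - q) * h (a ord0) + q * h (b ord0) + \sum_(j | j != ord0) h (a j).
Proof.
rewrite /wsum (bigD1 ord0)//=; congr (_ + _); apply: eq_bigr => j j0.
by rewrite ab//; ring.
Qed.

Lemma wsum_uncovered Z h : (forall z, z \in Z -> h z = 0) ->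
  wsum h = (1 - q) * h (a ord0) + q * h (b ord0) +
           \sum_(j in uncovered Z | j != ord0) h (a j).
Proof.
move=> hZ; rewrite wsum_split; congr (_ + _).
rewrite (bigID (mem (uncovered Z)))/= addrC big1 ?add0r.
  by apply: eq_bigl => j; rewrite andbC.
by move=> j /andP[j0 jU]; apply/hZ/covered_mem.
Qed.

Definition half_covered Z := (a ord0 \in Z) (+) (b ord0 \in Z).
(** Meant for a half covered [Z]: the base point without a center and, below, its mass, which bounds
    the cost once all other clusters are served. *)
Definition other Z := if a ord0 \in Z then b ord0 else a ord0.
Definition other_mass Z := if a ord0 \in Z then q else 1 - q.

Lemma half_covered_base Z : half_covered Z -> ord0 \notin uncovered Z.
Proof. by rewrite /half_covered inE; case: (_ \in Z); case: (_ \in Z). Qed.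

Lemma wsum_half_covered Z h : half_covered Z -> (forall z, z \in Z -> h z = 0) ->
  wsum h = other_mass Z * h (other Z) + \sum_(j in uncovered Z) h (a j).
Proof.
move=> hc hZ; rewrite (wsum_uncovered hZ) [in RHS](eq_bigl (fun j =>
    (j \in uncovered Z) && (j != ord0))); last first.
  move=> j; have [->|] := eqVneq j ord0; last by rewrite andbT.
  by rewrite (negbTE (half_covered_base hc)).
congr (_ + _); move: hc; rewrite /half_covered /other_mass /other.
case: ifP => [aZ|_] /=; first by rewrite (hZ _ aZ) mulr0 add0r.
by move=> bZ; rewrite (hZ _ bZ) mulr0 addr0.
Qed.

Lemma other_mass_ge0 Z : 0 <= other_mass Z.
Proof. by move: q_gt0 q_le => ? ?; rewrite /other_mass; case: ifP => _; lra. Qed.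

Lemma cdist_other Z : half_covered Z -> cdist Z (other Z) <= 1.
Proof.
rewrite /half_covered /other -base_dist; case: ifP => [aZ _|_ /= bZ].
  by rewrite edistC cdist_le.
exact: cdist_le.
Qed.

Lemma cdist_uncovered Z j : Z != [::] -> all atom Z -> j \in uncovered Z ->
  j != ord0 -> g * 2 ^+ j.-1 <= cdist Z (a j).
Proof.
move=> Z0 /allP atZ jU j0; apply: cdist_ge => // c cZ.
have /existsP[i ci] := atZ c cZ.
have ij : i != j.
  apply: contraTneq jU => <-; rewrite inE; move: (ci); rewrite !inE.
  by move=> /orP[]/eqP cE; rewrite -cE cZ ?andbF.
exact: separated ci.
Qed.

(** The largest of s distinct positive indices is at least s, and the separation grows geometrically
    in the index. *)
Lemma exists_far_uncovered Z : Z != [::] -> all atom Z ->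
  ord0 \notin uncovered Z -> (0 < #|uncovered Z|)%N ->
  exists2 j, j \in uncovered Z & g * 2 ^+ #|uncovered Z|.-1 <= cdist Z (a j).
Proof.
move=> Z0 atZ U0 /card_gt0P[j0 j0U].
pose M := [arg max_(i > j0 in uncovered Z) (i : nat)].
have [MU Mmax] : M \in uncovered Z /\
    (forall i, i \in uncovered Z -> (i <= M)%N).
  by rewrite /M; case: arg_maxnP.
have nz i : i \in uncovered Z -> i != ord0 by apply: contraTneq => ->.
exists M => //; apply: le_trans (cdist_uncovered Z0 atZ MU (nz M MU)).
rewrite ler_wpM2l//; first exact: le_trans g_ge1.
apply: ler_weXn2l; first lra.
(* Pigeonhole: the uncovered indices are distinct members of the list 1, ..., [M]. *)
rewrite -!subn1 leq_sub2r// -[leqRHS](size_iota 1).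
rewrite cardE -(size_map val); apply: uniq_leq_size.
  by rewrite map_inj_uniq ?enum_uniq//; apply: val_inj.
move=> _ /mapP[i + ->]; rewrite mem_enum => iU.
by rewrite mem_iota add1n ltnS Mmax// andbT lt0n; exact: nz.
Qed.

(** * D^alpha seeding on separated clusters *)

Section Dalpha.
Variable p : R.
Hypothesis p_gt2 : 2 < p.
Local Notation rho := (2 `^ (2 - p) : R).

Let p_gt0 : 0 < p. Proof. exact: lt_trans p_gt2. Qed.

Lemma rcost_after_le r Z : Z != [::] -> rcost_after a b q (rstep p) r Z <= rcost Z.
Proof.
elim: r Z => [//|r IH] Z Z0 /=.
apply: rsample_le => //; first by move=> x; apply: weight_ge0.
  exact: rcost_ge0.
have H z : weight p Z z * rcost_after a b q (rstep p) r (z :: Z) <=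
    weight p Z z * rcost Z.
  apply: ler_wpM2l; first exact: weight_ge0.
  apply: le_trans (IH _ _) _ => //.
  by apply: le_wsum => // i; rewrite ler_sqr ?nnegrE ?cdist_ge0// cdist_cons.
by rewrite [leRHS]mulrC -wsumZr; apply: le_wsum => // i.
Qed.

Lemma rcost_covered_le Z : Z != [::] -> a ord0 \in Z -> b ord0 \in Z ->
  rcost Z <= \sum_(j in uncovered Z) cdist Z (a j) ^+ 2.
Proof.
move=> Z0 aZ bZ; rewrite /rcost (@wsum_uncovered Z); last first.
  by move=> z zZ; rewrite cdist_mem// expr0n.
rewrite !cdist_mem// expr0n !mulr0 !add0r [leRHS](bigID (fun j => j != ord0))/=.
by rewrite lerDl sumr_ge0// => j _; rewrite sqr_ge0.
Qed.

(** Accumulated relative loss from a second center in the base cluster; term [v] bounds the loss at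
    the step where [v.+1] clusters are uncovered. *)
Definition waste r : R := \sum_(v < r) v.+1%:R * rho ^+ v.

Lemma waste_ge0 r : 0 <= waste r.
Proof.
by apply: sumr_ge0 => v _; rewrite mulr_ge0 ?exprn_ge0 ?powR_ge0.
Qed.

(** If [D] is the largest distance of an uncovered cluster, the left side is at most
    [r.+1%:R * D ^+ 2]. Write [D ^+ 2] as [D] to the [2 - p] times [D] to the [p]: the first factor
    is at most [rho ^+ r] because [D >= 2 ^+ r], and the second is one of the weights. *)
Lemma sum_sqr_cdist_le Z r : Z != [::] -> all atom Z ->
  ord0 \notin uncovered Z -> #|uncovered Z| = r.+1 ->
  \sum_(j in uncovered Z) cdist Z (a j) ^+ 2 <=
  r.+1%:R * rho ^+ r * \sum_(j in uncovered Z) weight p Z (a j).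
Proof.
move=> Z0 atZ U0 Ur.
have [j jU far] : exists2 j, j \in uncovered Z & g * 2 ^+ r <= cdist Z (a j).
  by have := @exists_far_uncovered Z Z0 atZ U0; rewrite Ur; apply.
pose M := [arg max_(i > j in uncovered Z) cdist Z (a i)]%O.
have [MU Mmax] : M \in uncovered Z /\
    (forall i, i \in uncovered Z -> cdist Z (a i) <= cdist Z (a M)).
  by rewrite /M; case: arg_maxP => // i iU imax; split => // k /imax.
set D := cdist Z (a M) in Mmax *.
have D2 : 2 ^+ r <= D.
  apply: le_trans (Mmax j jU); apply: le_trans far.
  by rewrite ler_peMl// exprn_ge0.
have r2 : 1 <= 2 ^+ r :> R by rewrite exprn_ege1 ?ler1n.
have D0 : 0 < D by lra.
apply: (@le_trans _ _ (r.+1%:R * D ^+ 2)).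
  rewrite -Ur mulr_natl -sumr_const; apply: ler_sum => i iU.
  by rewrite ler_sqr ?nnegrE ?cdist_ge0// Mmax.
rewrite -mulrA ler_wpM2l//.
have -> : D ^+ 2 = D `^ (2 - p) * D `^ p.
  by rewrite -powRD ?subrK ?powR_mulrn ?(ltW D0)// (gt_eqF D0) implybT.
apply: ler_pM; rewrite ?powR_ge0//.
  have -> : rho ^+ r = (2 ^+ r) `^ (2 - p).
    by rewrite -(powR_mulrn r (powR_ge0 2 _)) -powRrM mulrC powRrM powR_mulrn.
  have p2 : 0 <= p - 2 by rewrite subr_ge0 ltW.
  rewrite -(opprB p 2) !powRN lef_pV2 ?posrE ?powR_gt0 ?exprn_gt0//.
  by apply: ge0_ler_powR => //; rewrite nnegrE ?(ltW D0)// exprn_ge0.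
rewrite (bigD1 M)//= weight.unlock lerDl sumr_ge0// => i _; exact: powR_ge0.
Qed.

(** The invariant is that as many steps remain as clusters are uncovered. A draw of an uncovered
    cluster preserves it. A draw of the other base point breaks it, but the resulting cost is at
    most a multiple of the uncovered weight, which cancels against the denominator of the sampling
    law. *)
Lemma rcost_after_half_covered Z r : half_covered Z -> all atom Z ->
  #|uncovered Z| = r ->
  rcost_after a b q (rstep p) r Z <= other_mass Z * (1 + waste r).
Proof.
elim: r Z => [|r IH] Z hc atZ Ur.
  rewrite /waste big_ord0 addr0 mulr1 /= /rcost (wsum_half_covered hc); last first.
    by move=> z zZ; rewrite cdist_mem// expr0n.
  rewrite big_pred0 ?addr0; last by move=> j; rewrite (cards0_eq Ur) inE.
  rewrite ler_piMr ?other_mass_ge0// expr_le1 ?cdist_ge0// cdist_other//.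
have Z0 : Z != [::] by apply: contraTneq hc => ->.
have U0 := half_covered_base hc.
rewrite /=; apply: rsample_le => //; first by move=> x; apply: weight_ge0.
  by rewrite mulr_ge0 ?other_mass_ge0// addr_ge0 ?waste_ge0.
rewrite !(wsum_half_covered hc); last first.
- by move=> z zZ; rewrite weight_mem// mul0r.
- by move=> z zZ; rewrite weight_mem.
set c := other_mass Z; have c0 : 0 <= c by apply: other_mass_ge0.
set wo := weight p Z (other Z).
set W := \sum_(j in uncovered Z) weight p Z (a j).
have W0 : 0 <= W by apply: sumr_ge0 => j _; apply: weight_ge0.
have wo0 : 0 <= wo by apply: weight_ge0.
have wo1 : wo <= 1 by apply: weight_le1 (cdist_other hc).
(* With both base points among the centers, the later steps are only used not to raise the cost. *)
have ho : rcost_after a b q (rstep p) r (other Z :: Z) <=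
    r.+1%:R * rho ^+ r * W.
  apply: le_trans (rcost_after_le _ _) _ => //.
  apply: le_trans (sum_sqr_cdist_le Z0 atZ U0 Ur).
  have UE : uncovered (other Z :: Z) = uncovered Z.
    rewrite (@uncovered_cons _ ord0); last first.
      by rewrite /other; case: ifP; rewrite !inE eqxx ?orbT.
    apply/setP => j; rewrite finset.in_setD1.
    by have [->|//] := eqVneq j ord0; rewrite (negbTE U0).
  apply: le_trans (rcost_covered_le _ _ _) _ => //.
  - by rewrite /other inE; case: ifPn => _; rewrite ?orbT ?eqxx.
  - rewrite /other inE; case: ifPn => [_|aZ]; first by rewrite eqxx.
    by move: hc; rewrite /half_covered (negbTE aZ) /= => ->; rewrite orbT.
  rewrite UE; apply: ler_sum => j _.
  by rewrite ler_sqr ?nnegrE ?cdist_ge0// cdist_cons.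
have hU : \sum_(j in uncovered Z) weight p Z (a j) *
      rcost_after a b q (rstep p) r (a j :: Z) <= W * (c * (1 + waste r)).
  rewrite /W mulr_suml; apply: ler_sum => j jU.
  rewrite ler_wpM2l ?weight_ge0//.
  have j0 : j != ord0 by apply: contraTneq jU => ->.
  have neq : (forall z, z \in [:: a ord0; b ord0] -> (z == a j) = false).
    move=> z z0; apply/eqP => zj; move/eqP: j0; apply.
    by apply: (@atom_cluster_inj _ _ z) => //; rewrite zj mem_head.
  have aE : (a ord0 \in a j :: Z) = (a ord0 \in Z).
    by rewrite inE neq ?mem_head.
  have bE : (b ord0 \in a j :: Z) = (b ord0 \in Z).
    by rewrite inE neq// !inE eqxx orbT.
  have -> : c = other_mass (a j :: Z) by rewrite /c /other_mass aE.
  apply: IH; first by rewrite /half_covered aE bE.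
    by rewrite /= atom_a.
  by move: Ur; rewrite (@card_uncovered_cons _ j (a j)) ?mem_head// => -[].
have wE : waste r.+1 = waste r + r.+1%:R * rho ^+ r by rewrite /waste big_ord_recr.
rewrite wE.
set e := r.+1%:R * rho ^+ r in ho *.
have e0 : 0 <= e by rewrite mulr_ge0 ?exprn_ge0 ?powR_ge0.
have := waste_ge0 r; set s := waste r => s0.
(* The wasted draw has weight [c * wo] with [wo <= 1]. The denominator [c * wo + W] is at least [W],
   which concludes. *)
apply: (@le_trans _ _ (c * (e * W) + W * (c * (1 + s)))).
  apply: lerD hU; rewrite ler_wpM2l//.
  apply: le_trans ho; rewrite ler_piMl// rcost_after_ge0//.
  by move=> Y h h0; apply: rstep_ge0.
rewrite (_ : _ + _ = c * (1 + (s + e)) * W); last by ring.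
rewrite ler_wpM2l ?mulr_ge0 ?addr_ge0//.
by rewrite lerDr mulr_ge0.
Qed.

Lemma wasteS r : waste r.+1 = \sum_(v < r.+1) rho ^+ v + rho * waste r.
Proof.
rewrite /waste [LHS]big_ord_recl [in RHS]big_ord_recl -[RHS]addrA; congr (_ + _).
  by rewrite /= expr0 mulr1.
rewrite mulr_sumr -big_split; apply: eq_bigr => v _ /=.
by rewrite /bump /= add1n -[v.+2%:R]natr1 exprS; ring.
Qed.

(** The bound is the sum of the full series. It is the fixed point of the recursion [wasteS] once
    the geometric sum there is replaced by [(1 - rho)^-1]. *)
Lemma waste_le r : waste r <= ((1 - rho) ^+ 2)^-1.
Proof.
have r0 : 0 <= rho by apply: powR_ge0.
have r1 : rho < 1.
  rewrite -(opprB p 2) powRN invf_lt1 ?powR_gt0//.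
  rewrite -[ltLHS](powRr0 2) lt_neqAle ler_powR ?ler1n ?subr_ge0 ?(ltW p_gt2)//.
  rewrite andbT powRr0 eq_sym powR_eq1 gt_eqF ?ltr1n//= ltNge ler0n/=.
  by rewrite subr_eq0 gt_eqF.
have r1' : 0 < 1 - rho by rewrite subr_gt0.
elim: r => [|r IH]; first by rewrite /waste big_ord0 invr_ge0 exprn_ge0// ltW.
rewrite wasteS; apply: (@le_trans _ _ ((1 - rho)^-1 + rho * ((1 - rho) ^+ 2)^-1)).
  apply: lerD; last exact: ler_wpM2l.
  rewrite -[leRHS]mul1r ler_pdivlMr//.
  rewrite mulrC -[X in X - _]/(1) -opprB mulNr -subrX1 opprB.
  by rewrite gerBl exprn_ge0.
rewrite le_eqVlt; apply/orP; left; apply/eqP; field.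
by rewrite gt_eqF.
Qed.

Hypothesis closer : forall j, j != ord0 ->
  edist (b ord0) (a j) <= edist (a ord0) (a j).

Lemma base_neq : a ord0 != b ord0.
Proof.
apply/eqP => ab0; have := base_dist; rewrite ab0 edistxx => /eqP.
by rewrite eq_sym oner_eq0.
Qed.

(** As long as the base cluster is uncovered, every center belongs to another cluster, and [closer]
    applies to each. *)
Lemma cdist_base_le Z : Z != [::] -> all atom Z -> ord0 \in uncovered Z ->
  cdist Z (b ord0) <= cdist Z (a ord0).
Proof.
move=> Z0 /allP atZ U0; apply: cdist_ge => // c cZ.
apply: le_trans (cdist_le _ cZ) _.
have /existsP[i ci] := atZ c cZ.
have i0 : i != ord0.
  apply: contraTneq U0 => <-; rewrite inE; move: ci; rewrite !inE.
  by move=> /orP[]/eqP cE; rewrite -cE cZ ?andbF.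
by move: ci; rewrite ab// !inE orbb => /eqP ->; apply: closer.
Qed.

Lemma half_covered_cons Z : ord0 \in uncovered Z ->
  half_covered (a ord0 :: Z) /\ half_covered (b ord0 :: Z).
Proof.
rewrite inE /half_covered !inE !eqxx => /andP[/negbTE -> /negbTE ->].
by rewrite eq_sym (negbTE base_neq).
Qed.

Section Bound.
Variable K : R.
Hypothesis K_ge : forall r, 1 + waste r <= K.

Let K0 : 0 <= K.
Proof. by apply: le_trans (K_ge 0); rewrite addr_ge0// waste_ge0. Qed.

Lemma rcost_after_main_covered Z r : ord0 \in uncovered Z -> all atom Z ->
  #|uncovered Z| = r.+1 ->
  rcost_after a b q (rstep p) r (a ord0 :: Z) <= q * K.
Proof.
move=> U0 atZ Ur; have [hc _] := half_covered_cons U0.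
have := @rcost_after_half_covered _ r hc; rewrite /other_mass mem_head.
move=> H; apply: le_trans (H _ _) _.
- by rewrite /= atom_a.
- by move: Ur; rewrite (@card_uncovered_cons _ ord0 (a ord0)) ?mem_head// => -[].
- by rewrite ler_wpM2l// ltW.
Qed.

Lemma rcost_after_outlier_covered Z r : ord0 \in uncovered Z -> all atom Z ->
  #|uncovered Z| = r.+1 ->
  rcost_after a b q (rstep p) r (b ord0 :: Z) <= K.
Proof.
move=> U0 atZ Ur; have [_ hc] := half_covered_cons U0.
apply: le_trans (rcost_after_half_covered (r := r) hc _ _) _.
- by rewrite /= atom_b.
- move: Ur; rewrite (@card_uncovered_cons _ ord0 (b ord0))// => [[]//|].
  by rewrite !inE eqxx orbT.
apply: le_trans (K_ge r); rewrite ler_piMl//.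
  by rewrite addr_ge0 ?waste_ge0.
by rewrite /other_mass; case: ifP => _; move: q_gt0 q_le => ? ?; lra.
Qed.

(** The next draw is the main point with weight [(1 - q) * X], leading to cost [q * K], or the
    outlier with weight [q * Y], leading to cost [K]. Since [Y <= X], both contribute order [q * K].
    Any other draw is covered by induction, and [r = 0] is void because the base cluster is still
    uncovered. *)
Lemma rcost_after_base_uncovered Z r : Z != [::] -> all atom Z ->
  ord0 \in uncovered Z -> #|uncovered Z| = r ->
  rcost_after a b q (rstep p) r Z <= 3 * q * K.
Proof.
elim: r Z => [|r IH] Z Z0 atZ U0 Ur; first by move: U0; rewrite (cards0_eq Ur) inE.
have M0 : 0 <= 3 * q * K by rewrite !mulr_ge0// ltW.
rewrite /=; apply: rsample_le => //; first by move=> x; apply: weight_ge0.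
rewrite !(@wsum_uncovered Z); last first.
- by move=> z zZ; rewrite weight_mem// mul0r.
- by move=> z zZ; rewrite weight_mem.
set X := weight p Z (a ord0); set Y := weight p Z (b ord0).
set W := \sum_(j in uncovered Z | j != ord0) weight p Z (a j).
have ha := rcost_after_main_covered U0 atZ Ur.
have hb := rcost_after_outlier_covered U0 atZ Ur.
have Y0 : 0 <= Y by apply: weight_ge0.
have X0 : 0 <= X by apply: weight_ge0.
have YX : Y <= X by apply: le_weight (cdist_base_le Z0 atZ U0).
have hU : \sum_(j in uncovered Z | j != ord0) weight p Z (a j) *
      rcost_after a b q (rstep p) r (a j :: Z) <= W * (3 * q * K).
  rewrite /W mulr_suml; apply: ler_sum => j /andP[jU j0].
  rewrite ler_wpM2l ?weight_ge0//; apply: IH => //.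
  - by rewrite /= atom_a.
  - rewrite (@uncovered_cons _ j) ?mem_head// finset.in_setD1 U0 andbT.
    by rewrite eq_sym.
  - by move: Ur; rewrite (@card_uncovered_cons _ j (a j)) ?mem_head// => -[].
have qc : 0 <= 1 - q by move: q_gt0 q_le => ? ?; lra.
apply: (@le_trans _ _ ((1 - q) * (X * (q * K)) + q * (Y * K) + W * (3 * q * K))).
  apply: lerD hU; apply: lerD; first by rewrite !ler_wpM2l.
  by rewrite !ler_wpM2l// ltW.
apply: base_uncovered_arith; rewrite ?Y0// (ltW q_gt0).
exact: q_le.
Qed.

(** The same three cases for the uniform first draw: the base cluster contributes at most
    [(1 - q) * (q * K) + q * K], and each other cluster [3 * q * K]. *)
Lemma seeding_Dalpha_le :
  rsample a b q (fun=> 1) (fun z => rcost_after a b q (rstep p) n [:: z]) <=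
  3 * q * K.
Proof.
have U0 : ord0 \in uncovered [::] by rewrite uncovered_nil inE.
have Un : #|uncovered [::]| = n.+1 by rewrite uncovered_nil cardsT card_ord.
have ha := rcost_after_main_covered U0 isT Un.
have hb := rcost_after_outlier_covered U0 isT Un.
have M0 : 0 <= 3 * q * K by rewrite !mulr_ge0// ltW.
apply: rsample_le => //.
rewrite !wsum_split.
have hU : \sum_(j < n.+1 | j != ord0) 1 * rcost_after a b q (rstep p) n [:: a j]
    <= \sum_(j < n.+1 | j != ord0) 1 * (3 * q * K).
  apply: ler_sum => j j0; rewrite !mul1r; apply: rcost_after_base_uncovered => //.
  - by rewrite /= atom_a.
  - rewrite (@uncovered_cons _ j) ?mem_head// finset.in_setD1 U0 andbT.
    by rewrite eq_sym.
  - by move: Un; rewrite (@card_uncovered_cons _ j (a j)) ?mem_head ?uncovered_nil ?inE// => -[].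
rewrite mulrDr; apply: lerD; last by rewrite mulrC mulr_suml.
rewrite !mul1r !mulr1 subrK mulr1.
have qc : 0 <= 1 - q by move: q_gt0 q_le => ? ?; lra.
apply: (@le_trans _ _ ((1 - q) * (q * K) + q * K)).
  by apply: lerD; rewrite ler_wpM2l// ltW.
have qK : 0 <= q * K by rewrite mulr_ge0// ltW.
have : q * (q * K) >= 0 by rewrite mulr_ge0// ltW.
by rewrite mulrBl mul1r -mulrA; lra.
Qed.

End Bound.
End Dalpha.

(** * Greedy seeding on separated clusters *)

Section Greedy.
Variable m : nat.
Hypothesis m_gt0 : (0 < m)%N.
Local Notation greedy := (rgreedy a b q m).
(** Once the outlier is a center, the main point has weight at most 1, against at least [g ^+ 2] for
    the uncovered clusters while any remain. So this bounds from below the probability that no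
    candidate is the main point. *)
Local Notation miss := ((1 - (g ^+ 2)^-1) ^+ m).

Lemma cdist_main_ge1 Z : a ord0 \notin Z -> b ord0 \in Z -> all atom Z ->
  1 <= cdist Z (a ord0).
Proof.
move=> aZ bZ /allP atZ; apply: cdist_ge => [|c cZ]; first by case: Z bZ {aZ atZ}.
have /existsP[i ci] := atZ c cZ.
have [i0|i0] := eqVneq i ord0.
  move: ci; rewrite i0 !inE => /orP[]/eqP cE; last by rewrite cE base_dist.
  by rewrite -cE cZ in aZ.
have i0' : ord0 != i by rewrite eq_sym.
move: ci; rewrite ab// !inE orbb => /eqP ->; rewrite edistC.
apply: le_trans (separated i0 i0' (mem_head _ _)).
by rewrite -[leLHS]mulr1 ler_pM// exprn_ege1// ler1n.
Qed.

Lemma miss_bounds : 0 <= 1 - (g ^+ 2)^-1 <= 1.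
Proof.
have g2 : 1 <= g ^+ 2 by apply: exprn_ege1.
rewrite subr_ge0 gerBl invf_le1 ?invr_ge0 ?g2 ?(le_trans _ g2)//.
exact: lt_le_trans g2.
Qed.

(** If no candidate is the main point, whichever wins covers a new cluster, so the numbers of steps
    and of uncovered clusters stay equal. When this happens at all [r] steps, the mass [1 - q] is
    left at distance at least 1. *)
Lemma rcost_after_outlier_ge Z r : a ord0 \notin Z -> b ord0 \in Z ->
  all atom Z -> #|uncovered Z| = r ->
  (1 - q) * miss ^+ r <= rcost_after a b q greedy r Z.
Proof.
have qc : 0 <= 1 - q by move: q_gt0 q_le => ? ?; lra.
have /andP[miss0 miss1] := miss_bounds.
elim: r Z => [|r IH] Z aZ bZ atZ Ur.
  have hc : half_covered Z by rewrite /half_covered (negbTE aZ) bZ.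
  rewrite expr0 mulr1 /= /rcost (wsum_half_covered hc); last first.
    by move=> z zZ; rewrite cdist_mem// expr0n.
  rewrite big_pred0 ?addr0; last by move=> j; rewrite (cards0_eq Ur) inE.
  rewrite /other_mass /other (negbTE aZ) ler_peMr// exprn_ege1//.
  exact: cdist_main_ge1.
have hc : half_covered Z by rewrite /half_covered (negbTE aZ) bZ.
have Z0 : Z != [::] by case: Z bZ {IH aZ atZ Ur hc}.
have U0 := half_covered_base hc.
have w0 x : 0 <= weight 2 Z x by apply: weight_ge0.
set W := \sum_(j in uncovered Z) weight 2 Z (a j).
have Wg : g ^+ 2 <= W.
  have U_gt0 : (0 < #|uncovered Z|)%N by rewrite Ur.
  have [j jU far] := exists_far_uncovered Z0 atZ U0 U_gt0.
  rewrite /W (bigD1 j)//= weight2.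
  apply: (@le_trans _ _ (cdist Z (a j) ^+ 2)); last first.
    by rewrite lerDl sumr_ge0.
  have g0 : 0 <= g by apply: le_trans g_ge1.
  rewrite ler_sqr ?nnegrE ?cdist_ge0//; apply: le_trans far.
  by rewrite ler_peMr// exprn_ege1// ler1n.
have g2 : 0 < g ^+ 2 by rewrite exprn_gt0// (lt_le_trans _ g_ge1).
have wE : wsum (fun x => weight 2 Z x) = (1 - q) * weight 2 Z (a ord0) + W.
  rewrite (wsum_half_covered hc) /other_mass /other ?(negbTE aZ)//.
  by move=> z zZ; rewrite weight2 cdist_mem// expr0n.
have a1 : 0 <= weight 2 Z (a ord0) <= 1.
  rewrite weight2 sqr_ge0/= expr_le1 ?cdist_ge0//.
  by have := cdist_other hc; rewrite /other (negbTE aZ).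
have a1' : 0 <= (1 - q) * weight 2 Z (a ord0) <= 1.
  case/andP: a1 => a0 a1; rewrite mulr_ge0//=.
  by rewrite mulr_ile1//; move: q_gt0 => ?; lra.
rewrite exprS mulrCA.
pose G z := [exists j in uncovered Z, z == a j].
have Gin z : G z -> exists2 j, j \in uncovered Z & z = a j.
  by move=> /existsP[j /andP[jU /eqP ->]]; exists j.
rewrite /= /rgreedy; apply: (@riid_all_ge _ _ _ _ _ _ q01 _ G) => //.
- by rewrite wE; apply: lt_le_trans g2 _; rewrite (le_trans Wg)// lerDr; case/andP: a1'.
- by rewrite mulr_ge0// !exprn_ge0.
- rewrite wE (wsum_half_covered hc); last first.
    by move=> z zZ; rewrite weight2 cdist_mem// expr0n mul0r.
  rewrite (eq_bigr (fun j => weight 2 Z (a j))); last first.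
    move=> j jU; rewrite (_ : G (a j)) ?mulr1//.
    by apply/existsP; exists j; rewrite jU eqxx.
  rewrite -/W; case/andP: a1' => a0' a1'.
  apply: (@le_trans _ _ W); last first.
    by rewrite lerDr !mulr_ge0// other_mass_ge0.
  rewrite mulrBl mul1r lerBlDl lerD2r; apply: le_trans a1' _.
  rewrite mulrC ler_pdivlMr// mul1r; apply: le_trans Wg _.
  by rewrite lerDr.
- by move=> s; apply: rcost_after_ge0 => // Y h h0; apply: rgreedy_ge0.
- move=> s sm /allP sG.
  (* With [m > 0] the winner is a drawn candidate and not the default [origin]. *)
  have s0 : s != [::] by apply: contraTneq m_gt0 => s0; rewrite -sm s0.
  have [bs _] := best_candidate_min (clusters a b q) Z s0.
  have [j jU ->] := Gin _ (sG _ bs).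
  have j0 : j != ord0 by apply: contraTneq jU => ->.
  apply: IH.
  + rewrite inE negb_or aZ andbT; apply/eqP => E.
    move/eqP: j0; apply; apply: (@atom_cluster_inj _ _ (a j)).
      by rewrite mem_head.
    by rewrite -E mem_head.
  + by rewrite inE bZ orbT.
  + by rewrite /= atom_a.
  + by move: Ur; rewrite (@card_uncovered_cons _ j (a j)) ?mem_head// => -[].
Qed.

Hypothesis outlier_best : forall j y, (1 < j)%N -> atom y ->
  y \notin [:: a j; b ord0] -> rcost [:: b ord0; a j] < rcost [:: y; a j].
(** The cost is also the total weight for exponent 2, so each candidate is the outlier with
    probability at least [q / 6]. *)
Hypothesis outlier_prob : forall j, (1 < j)%N ->
  q / 6 * rcost [:: a j] <= q * cdist [:: a j] (b ord0) ^+ 2.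

(** The first factor bounds the probability that the outlier is among the [m] candidates, and then
    it wins. After [a j] and the outlier, [r] steps and [r] uncovered clusters remain. *)
Lemma rcost_after_far_ge j r : (1 < j)%N -> n = r.+1 ->
  (1 - (1 - q / 6) ^+ m) * ((1 - q) * miss ^+ r) <=
  rcost_after a b q greedy r.+1 [:: a j].
Proof.
move=> j1 nr.
have qc : 0 <= 1 - q by move: q_gt0 q_le => ? ?; lra.
have /andP[miss0 miss1] := miss_bounds.
have j0 : j != ord0 by apply: contraTneq j1 => ->.
have neq z : z \in [:: a ord0; b ord0] -> z != a j.
  move=> z0; apply: contra j0 => /eqP zj; apply/eqP.
  by apply: (@atom_cluster_inj _ _ z) => //; rewrite zj mem_head.
have aj : a ord0 != a j by rewrite neq ?mem_head.
have bj : b ord0 != a j by rewrite neq// !inE eqxx orbT.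
have w0 x : 0 <= weight 2 [:: a j] x by apply: weight_ge0.
have wE : wsum (fun x => weight 2 [:: a j] x) = rcost [:: a j].
  by congr wsum; apply/funext => x; rewrite weight2.
have edist_bj : 1 <= edist (b ord0) (a j).
  rewrite edistC; have i0' : ord0 != j by rewrite eq_sym.
  apply: le_trans (separated (z := b ord0) j0 i0' _); last by rewrite !inE eqxx orbT.
  by rewrite -[leLHS]mulr1 ler_pM// exprn_ege1// ler1n.
have b1 : 1 <= cdist [:: a j] (b ord0).
  by apply: cdist_ge => // c; rewrite inE => /eqP ->.
have W0 : 0 < rcost [:: a j].
  rewrite /rcost wsum_split.
  have : 0 < q * cdist [:: a j] (b ord0) ^+ 2.
    by rewrite mulr_gt0// exprn_gt0// (lt_le_trans _ b1).
  have : 0 <= (1 - q) * cdist [:: a j] (a ord0) ^+ 2 by rewrite mulr_ge0// sqr_ge0.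
  have : 0 <= \sum_(i < n.+1 | i != ord0) cdist [:: a j] (a i) ^+ 2.
    by apply: sumr_ge0 => i _; rewrite sqr_ge0.
  by move=> ? ? ?; lra.
(* The point [a j] has weight 0, so excluding it loses no probability; [outlier_best] does not
   compare with it. *)
pose G z := atom z && (z != a j).
rewrite /= /rgreedy.
apply: (@riid_some_ge _ _ _ _ _ _ q01 _ G (b ord0)) => //.
- by rewrite wE.
- by rewrite mulr_ge0// exprn_ge0// exprn_ge0.
- by move: q_gt0 q_le => ? ?; apply/andP; split; lra.
- by rewrite /G atom_b bj.
- have H z : atom z -> weight 2 [:: a j] z <= weight 2 [:: a j] z * (G z)%:R.
    move=> az; rewrite /G az /=; case: eqP => [->|_] /=; last by rewrite mulr1.
    by rewrite weight2 cdist_mem ?mem_head// expr0n mulr0.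
  by apply: le_wsum => // i; apply: H; [exact: atom_a|exact: atom_b].
- rewrite wE; apply: le_trans (outlier_prob j1) _.
  rewrite wsum_split eqxx mulr1 [weight _ _ (b ord0)]weight2 -addrA addrCA lerDl addr_ge0//.
    by rewrite mulr_ge0// mulr_ge0.
  by apply: sumr_ge0 => i _; rewrite mulr_ge0.
- by move=> s; apply: rcost_after_ge0 => // Y h h0; apply: rgreedy_ge0.
- move=> s sm /allP sG bs.
  rewrite (best_candidate_unique bs); last first.
    move=> y ys yb; rewrite !costE// lte_fin; apply: outlier_best => //.
      by case/andP: (sG y ys).
    by rewrite !inE negb_or yb andbT; case/andP: (sG y ys).
  apply: rcost_after_outlier_ge.
  + by rewrite !inE negb_or aj base_neq.
  + exact: mem_head.
  + by rewrite /= atom_b atom_a.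
  + have Un : #|uncovered [::]| = n.+1 by rewrite uncovered_nil cardsT card_ord.
    have U1 : #|uncovered [:: a j]| = n.
      apply: succn_inj; rewrite -(@card_uncovered_cons _ j (a j)) ?mem_head//.
      by rewrite uncovered_nil inE.
    apply: succn_inj; rewrite -nr -[RHS]U1 -(@card_uncovered_cons _ ord0)//.
      by rewrite !inE eqxx orbT.
    by rewrite !inE aj bj.
Qed.

End Greedy.
End SeparatedClusters.

(** * The uniform first center *)

Section GreedySeeding.
Context (R : realType) (d r : nat) (a b : 'I_r.+2 -> euclid R d) (q : R).
Local Open Scope ring_scope.
Hypothesis q01 : 0 <= q <= 1.

(** Of the [r.+2] clusters, [r] have index above 1, which is at least half of them once [r >= 2]. *)
Lemma rsample_uniform_ge (h : euclid R d -> R) v : (2 <= r)%N -> 0 <= v ->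
  (forall x, 0 <= h x) ->
  (forall i : 'I_r.+2, (1 < i)%N -> v <= h (a i) /\ v <= h (b i)) ->
  v / 2 <= rsample a b q (fun=> 1) h.
Proof.
move=> r2 v0 h0 hv; have /andP[q0 q1] := q01.
have q1' : 0 <= 1 - q by rewrite subr_ge0.
have W : wsum a b q (fun=> 1) = r.+2%:R.
  by rewrite /wsum (eq_bigr (fun=> 1)) ?sumr_const ?card_ord// => i _; rewrite !mulr1 subrK.
apply: rsample_ge; rewrite W ?ltr0n//.
rewrite /wsum !big_ord_recl /=.
apply: (@le_trans _ _ (\sum_(i < r) v)).
  rewrite sumr_const card_ord -[v *+ r]mulr_natr -mulrA ler_wpM2l//.
  rewrite ler_pdivrMl// -natrM ler_nat.
  by rewrite mulSn mul1n; apply: leq_trans (leq_add r2 (leqnn r)).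
rewrite addrA ler_wpDl//.
  by rewrite !mul1r; do 2!apply: addr_ge0; apply: mulr_ge0.
apply: ler_sum => i _; rewrite !mul1r.
have [|va vb] := hv (lift ord0 (lift ord0 i)); first by [].
rewrite -[leLHS]mul1r -[X in X * _](subrK q) mulrDl.
by apply: lerD; apply: ler_wpM2l.
Qed.

End GreedySeeding.

(** * The instance on the line *)

Section Bernoulli.
Context (R : realType).
Local Open Scope ring_scope.

Lemma bernoulli_lower (s : R) N : 0 <= s <= 1 -> 1 - N%:R * s <= (1 - s) ^+ N.
Proof.
move=> /andP[s0 s1]; elim: N => [|N IH]; first by rewrite mul0r subr0 expr0.
rewrite exprS; apply: (@le_trans _ _ ((1 - s) * (1 - N%:R * s))).
  have : 0 <= N%:R * s ^+ 2 by rewrite mulr_ge0// sqr_ge0.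
  by rewrite -natr1; nra.
by apply: ler_wpM2l => //; rewrite subr_ge0.
Qed.

(** Companion of the Bernoulli inequality. The induction drops the square from [(1 - t) * (1 +
    N.+1%:R * t) = 1 + N%:R * t - N.+1%:R * t ^+ 2]. *)
Lemma bernoulli_upper (t : R) N : 0 <= t <= 1 ->
  (1 - t) ^+ N * (1 + N%:R * t) <= 1.
Proof.
move=> /andP[t0 t1]; elim: N => [|N IH]; first by rewrite mul0r addr0 mulr1 expr0.
apply: le_trans IH; rewrite exprSr -mulrA; apply: ler_wpM2l.
  by rewrite exprn_ge0// subr_ge0.
have : 0 <= N.+1%:R * t ^+ 2 by rewrite mulr_ge0// sqr_ge0.
by rewrite -natr1; nra.
Qed.

(** A crude bound suffices, since greedy loses a factor of order [m]. With [y = ln m], use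
    [ln y <= y] and [(y / 2) ^+ 2 <= expR y]; where [ln y] is negative, [y >= 2^-1] keeps it above
    -1. *)
Lemma lnln_sqr_le (m : nat) : (0 < m)%N -> ln (ln (m%:R : R)) ^+ 2 <= 4 * m.+1%:R.
Proof.
(* For one candidate the inner logarithm is 0, and [ln 0] is 0 by convention. *)
case: m => // -[_|m _]; first by rewrite ln1 ln0// expr0n mulr_ge0.
set M : R := m.+2%:R; have M2 : 2 <= M by rewrite ler_nat.
have M3 : 4 * M <= 4 * m.+3%:R by rewrite ler_wpM2l// ler_nat.
move: M M2 M3 => M M2 M3; have M0 : 0 < M by lra.
have lnge (x : R) : 0 < x -> 1 - x^-1 <= ln x.
  move=> x0; have := le_ln1Dx (x := x^-1 - 1).
  rewrite subrKC lnV ?posrE// => H.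
  by have := H _; rewrite ltrBDl subrr invr_gt0 => /(_ x0); lra.
have y2 : 2^-1 <= ln M.
  apply: le_trans (lnge M M0).
  have : M^-1 <= 2^-1 by rewrite lef_pV2 ?posrE//; lra.
  by move=> ?; lra.
have lnK' := lnK M0; move: (ln M) y2 lnK' => y y2 yK.
have y0 : 0 < y by lra.
have yM : y ^+ 2 <= 4 * M.
  have : y / 2 <= expR (y / 2) by apply: le_trans (expR_ge1Dx _); lra.
  move=> h; have : (y / 2) ^+ 2 <= expR (y / 2) ^+ 2.
    by rewrite ler_sqr ?nnegrE ?expR_ge0//; lra.
  rewrite -expRM_natl -[2%:R * _]mulrC divfK// yK.
  by rewrite expr_div_n; lra.
have lny_hi : ln y <= y.
  by have := lnge y^-1; rewrite invr_gt0 invrK lnV ?posrE// => /(_ y0); lra.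
have lny_lo : -1 <= ln y.
  apply: le_trans (lnge y y0).
  have : y^-1 <= 2 by rewrite -[leRHS]invrK lef_pV2 ?posrE//; lra.
  by lra.
apply: le_trans M3.
have [l0|l0] := leP 0 (ln y).
  by apply: le_trans yM; rewrite ler_sqr ?nnegrE// ltW.
have : ln y ^+ 2 <= 1 by nra.
by lra.
Qed.

End Bernoulli.

(** * Positions, separation and cost comparisons on the line *)

Section LineInstance.
Context (R : realType) (r m : nat).
Local Open Scope ring_scope.
Hypothesis m_gt0 : (0 < m)%N.

Definition point (t : R) : euclid R 1 := [tuple of [:: t]].

Lemma tnth_point t j : tnth (point t) j = t.
Proof. by case: j => -[|//] lt01; rewrite (tnth_nth 0). Qed.

Lemma edist_point s t : edist (point s) (point t) = `|s - t|.
Proof. by rewrite /edist big_ord1 !(tnth_nth 0)/= sqrtr_sqr. Qed.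

(** Large enough that [(m * r)%:R / gap ^+ 2 <= 2^-1]: with this, the [m] candidates of [r] greedy
    steps all avoid the main point with probability at least one half. *)
Definition gap : R := (2 * m * r.+2)%:R.
(** The last factor makes [far ^+ 2] dominate the cost of serving all far clusters from one of
    them. *)
Definition far : R := gap * 2 ^+ r.+2 * r.+2%:R.

Definition position (j : nat) : R := gap * 2 ^+ j + (if (1 < j)%N then far else 0).

Definition main_point (i : 'I_r.+2) : euclid R 1 :=
  point (if i == ord0 then 0 else position i).
Definition side_point (i : 'I_r.+2) : euclid R 1 :=
  point (if i == ord0 then 1 else position i).
Local Notation a := main_point.
Local Notation b := side_point.

(** Using [m.+1] keeps the mass at most one half even for [m = 1]. *)
Definition side_mass : R := m.+1%:R^-1.
Local Notation q := side_mass.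

Lemma side_mass_gt0 : 0 < q.
Proof. by rewrite invr_gt0. Qed.

Lemma side_mass_le : q <= 2^-1.
Proof. by rewrite lef_pV2 ?posrE// ler_nat. Qed.

Lemma gap_ge1 : 1 <= gap.
Proof. by rewrite ler1n !muln_gt0 m_gt0. Qed.

Lemma gap_ge0 : 0 <= gap.
Proof. exact: ler0n. Qed.

Lemma far_ge0 : 0 <= far.
Proof.
by apply: mulr_ge0 => //; apply: mulr_ge0; [exact: gap_ge0|exact: exprn_ge0].
Qed.

Lemma far_ge_sqr : r.+2%:R * (gap * 2 ^+ r.+2) ^+ 2 <= far ^+ 2.
Proof.
rewrite /far [leRHS]exprMn [leRHS]mulrC ler_wpM2r ?sqr_ge0//.
by rewrite -natrX ler_nat -[leqLHS]expn1 leq_pexp2l.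
Qed.

Lemma gap_pow_le_far j : (j <= r.+2)%N -> gap * 2 ^+ j <= far.
Proof.
move=> jr; have g0 : 0 <= gap by apply: gap_ge0.
apply: (@le_trans _ _ (gap * 2 ^+ r.+2)).
  by rewrite ler_wpM2l// ler_weXn2l// ler1n.
by apply: ler_peMr; rewrite ?ler1n// mulr_ge0// exprn_ge0.
Qed.

Lemma gap_pow_ge1 j : 1 <= gap * 2 ^+ j.
Proof. by rewrite -[leLHS]mulr1 ler_pM ?gap_ge1// exprn_ege1// ler1n. Qed.

Lemma gap_powS j : gap * 2 ^+ j.+1 = 2 * (gap * 2 ^+ j).
Proof. by rewrite exprS; ring. Qed.

Lemma position_diff i j : (i < j)%N ->
  gap * 2 ^+ j.-1 <= position j - position i.
Proof.
case: j => // j ij; rewrite /position /=.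
have g0 : 0 <= gap by apply: gap_ge0.
have : gap * 2 ^+ i <= gap * 2 ^+ j.
  by rewrite ler_wpM2l// ler_weXn2l// ler1n.
rewrite gap_powS; have := far_ge0.
have [_|j1] := boolP (1 < j.+1)%N; first by case: ifP => _; lra.
case: ifPn => [i1|_]; last by lra.
by rewrite (ltn_trans i1 ij) in j1.
Qed.

Lemma position_ge j : gap * 2 ^+ j <= position j.
Proof. by rewrite /position lerDl; case: ifP => // _; apply: far_ge0. Qed.

Lemma position_ge0 j : 0 <= position j.
Proof. by apply: le_trans (position_ge j); rewrite mulr_ge0 ?gap_ge0 ?exprn_ge0. Qed.

Lemma position_ge_far j : (1 < j)%N -> far + 4 * gap <= position j.
Proof.
move=> j1; rewrite /position j1 addrC lerD2r mulrC ler_wpM2l ?gap_ge0//.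
by rewrite -natrX ler_nat (@leq_pexp2l 2 2 j).
Qed.

Lemma position1 : position 1 = 2 * gap.
Proof. by rewrite /position /= addr0 expr1 mulrC. Qed.

Lemma a_ord0 : a ord0 = point 0. Proof. by []. Qed.
Lemma b_ord0 : b ord0 = point 1. Proof. by []. Qed.
Lemma a_pos (j : 'I_r.+2) : j != ord0 -> a j = point (position j).
Proof. by rewrite /main_point => /negbTE ->. Qed.

Lemma side_eq_main (j : 'I_r.+2) : j != ord0 -> b j = a j.
Proof. by rewrite /main_point /side_point => /negbTE ->. Qed.

Lemma base_edist : edist (a ord0) (b ord0) = 1.
Proof. by rewrite a_ord0 b_ord0 edist_point sub0r normrN normr1. Qed.

Lemma line_separated (i j : 'I_r.+2) z : j != ord0 -> i != j ->
  z \in [:: a i; b i] -> gap * 2 ^+ j.-1 <= edist (a j) z.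
Proof.
move=> j0 ij zi; have j_gt0 : (0 < j)%N by rewrite lt0n.
have pj := position_ge j; have p1 := gap_pow_ge1 j.-1.
rewrite -(prednK j_gt0) gap_powS prednK// in pj.
rewrite (a_pos j0); have [i0|i0] := eqVneq i ord0.
  move: zi; rewrite i0 a_ord0 b_ord0 !inE => /orP[]/eqP ->; rewrite edist_point.
    by rewrite subr0; apply: le_trans (ler_norm _); lra.
  by apply: le_trans (ler_norm _); lra.
move: zi; rewrite side_eq_main// !inE orbb a_pos// => /eqP ->.
rewrite edist_point; have [ltij|ltji|/val_inj/eqP] := ltngtP i j; last first.
- by rewrite (negbTE ij).
- rewrite distrC; apply: le_trans (ler_norm _); apply: le_trans (position_diff ltji).
  rewrite ler_wpM2l ?gap_ge0// ler_weXn2l ?ler1n//.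
  by rewrite -!subn1 leq_sub2r// ltnW.
- by apply: le_trans (ler_norm _); apply: position_diff.
Qed.

Lemma line_closer (j : 'I_r.+2) : j != ord0 ->
  edist (b ord0) (a j) <= edist (a ord0) (a j).
Proof.
move=> j0; rewrite a_ord0 b_ord0 a_pos// !edist_point sub0r normrN.
have := position_ge j; have := gap_pow_ge1 j => ? ?.
by rewrite distrC !ger0_norm; lra.
Qed.

Local Notation rcost := (rcost a b q).

Let one : 'I_r.+2 := lift ord0 ord0.

(** The cost of the far clusters when all are served from cluster [j]. *)
Definition spread (j : 'I_r.+2) : R :=
  \sum_(i < r.+2 | (1 < i)%N) (position i - position j) ^+ 2.

Lemma position_dist_le (i j : 'I_r.+2) : (1 < i)%N -> (1 < j)%N ->
  `|position i - position j| <= gap * 2 ^+ r.+2.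
Proof.
move=> i1 j1; rewrite /position i1 j1 opprD addrACA subrr addr0 ler_norml.
have H (l : 'I_r.+2) : 1 <= gap * 2 ^+ l <= gap * 2 ^+ r.+2.
  rewrite gap_pow_ge1 ler_wpM2l ?gap_ge0// ler_weXn2l ?ler1n//.
  exact: ltnW.
have /andP[? ?] := H i; have /andP[? ?] := H j.
by apply/andP; split; lra.
Qed.

Lemma spread_le (j : 'I_r.+2) : (1 < j)%N -> spread j <= far ^+ 2.
Proof.
move=> j1; apply: le_trans far_ge_sqr.
rewrite (_ : _ * _ = \sum_(i < r.+2) (gap * 2 ^+ r.+2) ^+ 2); last first.
  by rewrite sumr_const card_ord mulr_natl.
rewrite /spread big_mkcond.
apply: ler_sum => i _; case: ifP => i1; last by rewrite sqr_ge0.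
have G0 : 0 <= gap * 2 ^+ r.+2 by rewrite mulr_ge0 ?gap_ge0 ?exprn_ge0.
rewrite -real_normK ?num_real// ler_sqr ?nnegrE//.
exact: position_dist_le.
Qed.

Lemma far_ge_gap : 2 * gap <= far.
Proof. by have := @gap_pow_le_far 1 isT; rewrite expr1 mulrC. Qed.

Lemma rcost_line Z : rcost Z =
  (1 - q) * cdist Z (point 0) ^+ 2 + q * cdist Z (point 1) ^+ 2 +
  cdist Z (point (2 * gap)) ^+ 2 +
  \sum_(i < r.+2 | (1 < i)%N) cdist Z (a i) ^+ 2.
Proof.
rewrite /rcost (wsum_split _ side_eq_main) (bigD1 one)//= addrA.
rewrite [a one]a_pos// position1; congr (_ + _).
by apply: eq_bigl => i; case: i => -[|[|i]].
Qed.

Lemma sqr_cdist_pair_ge (x y z : euclid R 1) t : 0 <= t ->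
  t <= edist x y -> t <= edist x z -> t ^+ 2 <= cdist [:: y; z] x ^+ 2.
Proof.
move=> t0 ty tz; rewrite ler_sqr ?nnegrE ?cdist_ge0//; apply: cdist_ge => // c.
by rewrite !inE => /orP[]/eqP ->.
Qed.

Lemma sqr_cdist_le Z (x y : euclid R 1) : y \in Z ->
  cdist Z x ^+ 2 <= edist x y ^+ 2.
Proof. by move=> yZ; rewrite ler_sqr ?nnegrE ?cdist_ge0 ?edist_ge0// cdist_le. Qed.

Lemma a_far (j : 'I_r.+2) : (1 < j)%N -> a j = point (position j).
Proof. by move=> j1; rewrite a_pos//; apply: contraTneq j1 => ->. Qed.

Lemma rcost_side_le (j : 'I_r.+2) : (1 < j)%N ->
  rcost [:: b ord0; a j] <= (1 - q) + (2 * gap - 1) ^+ 2 + spread j.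
Proof.
move=> j1; have q2 := side_mass_le; have q0 := side_mass_gt0.
rewrite rcost_line; apply: lerD; first apply: lerD.
- rewrite (@cdist_mem _ _ _ (point 1)) ?mem_head// expr0n mulr0 addr0.
  rewrite ler_piMr//; first by lra.
  apply: le_trans (sqr_cdist_le _ (mem_head _ _)) _.
  by rewrite base_edist expr1n.
- apply: le_trans (sqr_cdist_le _ (mem_head _ _)) _.
  by rewrite b_ord0 edist_point real_normK ?num_real.
- apply: ler_sum => i i1; have jZ : a j \in [:: b ord0; a j] by rewrite !inE eqxx orbT.
  apply: le_trans (sqr_cdist_le _ jZ) _.
  by rewrite !a_far// edist_point real_normK ?num_real.
Qed.

(** A center at coordinate at most [2 * gap] is at distance at least [far] from each far cluster,
    hence no nearer than [a j]. *)
Lemma spread_le_near (j : 'I_r.+2) (y : euclid R 1) t : (1 < j)%N ->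
  y = point t -> t <= 2 * gap ->
  spread j <= \sum_(i < r.+2 | (1 < i)%N) cdist [:: y; a j] (a i) ^+ 2.
Proof.
move=> j1 -> t2; apply: ler_sum => i i1.
rewrite -real_normK ?num_real//; apply: sqr_cdist_pair_ge; rewrite ?normr_ge0//.
  rewrite a_far// edist_point; apply: le_trans (position_dist_le i1 j1) _.
  apply: le_trans (gap_pow_le_far (leqnn _)) _.
  apply: le_trans (ler_norm _).
  by have := position_ge_far i1; have := gap_ge1 => ? ?; lra.
by rewrite !a_far// edist_point.
Qed.

Lemma le_edist_point (s t u : R) : u <= t - s -> u <= edist (point s) (point t).
Proof. by move=> h; rewrite edist_point distrC; apply: le_trans h (ler_norm _). Qed.

Lemma side_best (j : 'I_r.+2) y : (1 < j)%N -> atom a b y ->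
  y \notin [:: a j; b ord0] -> rcost [:: b ord0; a j] < rcost [:: y; a j].
Proof.
move=> j1 /existsP[i yi] yn; apply: le_lt_trans (rcost_side_le j1) _.
have q2 := side_mass_le; have q0 := side_mass_gt0; have g1 := gap_ge1.
have pj := position_ge_far j1; have fg := far_ge_gap.
rewrite rcost_line [a j]a_far//.
have [i0|i0] := eqVneq i ord0.
  (* Against the main point, the outlier saves [4 * gap - 1] on cluster 1 and loses only [1 - 2 * q]
     on the base cluster. *)
  have -> : y = point 0.
    move: yi yn; rewrite i0 !inE negb_or => /orP[]/eqP -> //.
    by rewrite eqxx andbF.
  have S := @spread_le_near j (point 0) 0 j1 erefl ltac:(lra).
  rewrite a_far// in S.
  have h1 : 1 ^+ 2 <= cdist [:: point 0; point (position j)] (point 1) ^+ 2.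
    apply: sqr_cdist_pair_ge => //; last by apply: le_edist_point; lra.
    by rewrite edistC; apply: le_edist_point; lra.
  have h2 : (2 * gap) ^+ 2 <=
      cdist [:: point 0; point (position j)] (point (2 * gap)) ^+ 2.
    apply: sqr_cdist_pair_ge; first by lra.
      by rewrite edistC; apply: le_edist_point; lra.
    by apply: le_edist_point; lra.
  have h1' : q * 1 <= q * cdist [:: point 0; point (position j)] (point 1) ^+ 2.
    by rewrite ler_wpM2l ?(ltW q0)//; move: h1; rewrite expr1n.
  have h0 : 0 <= (1 - q) * cdist [:: point 0; point (position j)] (point 0) ^+ 2.
    by rewrite mulr_ge0 ?sqr_ge0//; lra.
  by move: (cdist _ _) (cdist _ _) (cdist _ _) h0 h1 h1' h2 S => *; lra.
have yE : y = point (position i).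
  by move: yi; rewrite side_eq_main// !inE orbb => /eqP ->; exact: a_pos.
rewrite yE; have [i1|i1] := leqP i 1.
  have iE : (i : nat) = 1%N by apply/eqP; rewrite eqn_leq i1 lt0n.
  rewrite iE position1.
  have S := @spread_le_near j _ _ j1 erefl (lexx (2 * gap)).
  rewrite a_far// in S.
  have h0 : (2 * gap) ^+ 2 <=
      cdist [:: point (2 * gap); point (position j)] (point 0) ^+ 2.
    apply: sqr_cdist_pair_ge; first by lra.
      by apply: le_edist_point; lra.
    by apply: le_edist_point; lra.
  have h1 : (2 * gap - 1) ^+ 2 <=
      cdist [:: point (2 * gap); point (position j)] (point 1) ^+ 2.
    apply: sqr_cdist_pair_ge; first by lra.
      by apply: le_edist_point; lra.
    by apply: le_edist_point; lra.
  have h0' : (1 - q) * (2 * gap) ^+ 2 <=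
      (1 - q) * cdist [:: point (2 * gap); point (position j)] (point 0) ^+ 2.
    by rewrite ler_wpM2l//; lra.
  have h1' : q * (2 * gap - 1) ^+ 2 <=
      q * cdist [:: point (2 * gap); point (position j)] (point 1) ^+ 2.
    by rewrite ler_wpM2l// ltW.
  have h2 := sqr_ge0 (cdist [:: point (2 * gap); point (position j)] (point (2 * gap))).
  (* This is the margin over cluster 1: [(2 * gap) ^+ 2 - (2 * gap - 1) ^+ 2 - 1 = 4 * gap - 2],
     with mass [1 - q]. *)
  have key : 0 < (1 - q) * (4 * gap - 2) by apply: mulr_gt0; lra.
  apply: (@lt_le_trans _ _ ((1 - q) * (2 * gap) ^+ 2 + q * (2 * gap - 1) ^+ 2 + 0 + spread j)).
    by move: (spread j) key => *; lra.
  by apply: lerD S; apply: lerD h2; apply: lerD.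
(* A second far center leaves clusters 0 and 1 at distance at least [far], so it costs at least
   [2 * far ^+ 2], whereas [spread j] is at most [far ^+ 2]. *)
have pi := position_ge_far i1.
have h t : 0 <= t -> t <= 2 * gap ->
    far ^+ 2 <= cdist [:: point (position i); point (position j)] (point t) ^+ 2.
  move=> t0 t2; apply: sqr_cdist_pair_ge; first exact: far_ge0.
    by apply: le_edist_point; lra.
  by apply: le_edist_point; lra.
have h0 := h 0 (lexx _) ltac:(lra).
have h1 := h 1 ltac:(lra) ltac:(lra).
have h2 := h (2 * gap) ltac:(lra) (lexx _).
have h3 : 0 <= \sum_(l < r.+2 | (1 < l)%N)
    cdist [:: point (position i); point (position j)] (a l) ^+ 2.
  by apply: sumr_ge0 => l _; rewrite sqr_ge0.
have h0' : (1 - q) * far ^+ 2 <= (1 - q) *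
    cdist [:: point (position i); point (position j)] (point 0) ^+ 2.
  by rewrite ler_wpM2l//; lra.
have h1' : q * far ^+ 2 <=
    q * cdist [:: point (position i); point (position j)] (point 1) ^+ 2.
  by rewrite ler_wpM2l// ltW.
apply: (@lt_le_trans _ _ ((1 - q) * far ^+ 2 + q * far ^+ 2 + far ^+ 2 + 0)).
  have S := spread_le j1.
  have : (2 * gap) ^+ 2 <= far ^+ 2 by rewrite ler_sqr ?nnegrE//; lra.
  by move: (spread j) (far ^+ 2) S => *; lra.
by apply: lerD h3; apply: lerD h2; apply: lerD.
Qed.

(** With [x = position j], the base cluster, cluster 1 and the far clusters together each cost at
    most [x ^+ 2], and [3 * x ^+ 2 <= 6 * (x - 1) ^+ 2] because [x >= 4]. *)
Lemma side_prob (j : 'I_r.+2) : (1 < j)%N ->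
  q / 6 * rcost [:: a j] <= q * cdist [:: a j] (b ord0) ^+ 2.
Proof.
move=> j1; have q0 := side_mass_gt0; have q2 := side_mass_le.
have g1 := gap_ge1; have pj := position_ge_far j1; have fg := far_ge_gap.
have cE t : cdist [:: a j] (point t) = `|position j - t|.
  have [c] := @cdist_attained _ _ [:: a j] (point t) isT.
  by rewrite inE => /eqP -> ->; rewrite a_far// edist_point distrC.
rewrite rcost_line b_ord0 !cE !real_normK ?num_real// subr0.
have -> : \sum_(i < r.+2 | (1 < i)%N) cdist [:: a j] (a i) ^+ 2 = spread j.
  by apply: eq_bigr => i i1; rewrite [a i]a_far// cE real_normK ?num_real// -sqrrN opprB.
rewrite -mulrA ler_wpM2l ?(ltW q0)// mulrC ler_pdivrMr//.
set x := position j in pj *.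
have S := spread_le j1; have f0 := far_ge0.
have fx : far ^+ 2 <= x ^+ 2 by rewrite ler_sqr ?nnegrE//; lra.
have x1 : (x - 1) ^+ 2 <= x ^+ 2 by rewrite ler_sqr ?nnegrE//; lra.
have xg : (x - 2 * gap) ^+ 2 <= x ^+ 2 by rewrite ler_sqr ?nnegrE//; lra.
have qx : q * (x - 1) ^+ 2 <= q * x ^+ 2 by rewrite ler_wpM2l// ltW.
have x4 : 0 <= (x - 4) * x by rewrite mulr_ge0//; lra.
apply: (@le_trans _ _ (3 * x ^+ 2)); last by lra.
by move: (spread j) (far ^+ 2) ((x - 2 * gap) ^+ 2) S fx xg => *; lra.
Qed.

End LineInstance.

(** * Costs of both seedings on the line instance *)

Section LineCosts.
Context (R : realType) (r m : nat).
Hypotheses (m_gt0 : (0 < m)%N) (r_ge2 : (2 <= r)%N).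
Local Notation q := (side_mass R m).
Local Notation g := (gap R r m).

Definition line_clusters : 'I_r.+2 -> probability (euclid R 1) R :=
  clusters (@main_point R r m) (@side_point R r m) q.

Let q01 : (0 <= q <= 1)%R.
Proof.
rewrite (ltW (side_mass_gt0 _ _)) (le_trans (side_mass_le _ m_gt0))//.
by rewrite invf_le1// ler1n.
Qed.

Lemma line_reference_cost : reference_cost line_clusters = (q * (1 - q))%:E.
Proof.
rewrite /line_clusters (reference_costE q01).
- rewrite sumEFin (bigD1 ord0)//= base_edist expr1n mulr1 big1 ?addr0// => i i0.
  by rewrite side_eq_main// edistxx expr0n mulr0.
- by move=> i j; rewrite tnth_point; case: ifP => // _; exact: position_ge0.
- by move=> i j; rewrite tnth_point; case: ifP => // _; exact: position_ge0.
Qed.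

(** The factor 6 is the 3 of the seeding bound, doubled because the reference cost [q * (1 - q)] is
    at least [q / 2]. *)
Lemma line_Dalpha_cost (p : R) : (2 < p)%R ->
  Dalpha_cost line_clusters p <=
  (6 * (1 + ((1 - 2 `^ (2 - p)) ^+ 2)^-1))%:E * reference_cost line_clusters.
Proof.
move=> p2; rewrite line_reference_cost -EFinM.
rewrite /line_clusters (Dalpha_costE _ _ q01) ?(lt_trans _ p2)// lee_fin.
have q0 := side_mass_gt0 R m; have q2 := side_mass_le R m_gt0.
set K := (1 + ((1 - 2 `^ (2 - p)) ^+ 2)^-1)%R.
have K_ge s : (1 + waste p s <= K)%R by rewrite lerD2l waste_le.
have K0 : (0 <= K)%R by apply: le_trans (K_ge 0%N); rewrite addr_ge0// waste_ge0.
apply: (@le_trans _ _ (3 * q * K)%R).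
  apply: (seeding_Dalpha_le q0 q2 (gap_ge1 R r m_gt0)) => //.
  - exact: side_eq_main.
  - exact: base_edist.
  - by move=> i j z; apply: line_separated.
  - by move=> j; apply: line_closer.
have qK : (0 <= q * K)%R by rewrite mulr_ge0// ltW.
have : (q * (q * K) <= 2^-1 * (q * K))%R by rewrite ler_wpM2r.
by lra.
Qed.

(** The constant is 208 = 13 * 2 * 2 * 4: probability 1/13 that the outlier is a candidate, 1/2 that
    the main point is avoided afterwards, 1/2 that the first center is far, and 4 from
    [lnln_sqr_le]. *)
Lemma line_greedy_cost :
  (208^-1 * ln (ln m%:R) ^+ 2)%:E * reference_cost line_clusters <=
  greedy_cost line_clusters m.
Proof.
rewrite line_reference_cost -EFinM /line_clusters (greedy_costE _ _ q01) lee_fin.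
have q0 := side_mass_gt0 R m; have q2 := side_mass_le R m_gt0.
have g1 := gap_ge1 R r m_gt0.
set v := ((1 - (1 - q / 6) ^+ m) * ((1 - q) * (1 - (g ^+ 2)^-1) ^+ m ^+ r))%R.
have far_ge (j : 'I_r.+2) : (1 < j)%N ->
  (v <= rcost_after (@main_point R r m) (@side_point R r m) q
    (rgreedy (@main_point R r m) (@side_point R r m) q m) r.+1
    [:: @main_point R r m j])%R.
  move=> j1; apply: (rcost_after_far_ge q0 q2 g1) => //.
  - exact: side_eq_main.
  - exact: base_edist.
  - by move=> i l z; apply: line_separated.
  - by move=> i y i1; apply: side_best.
  - by move=> i i1; apply: side_prob.
have qm : (q * m.+1%:R = 1)%R by rewrite /side_mass mulVf.
have m1 : (1 <= m%:R :> R)%R by rewrite ler1n.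
(* Since [m%:R * q >= 2^-1], the expected number of hits is at least 1/12, and 1 - 1/(1 + 1/12) =
   1/13. *)
have hit : (13^-1 <= 1 - (1 - q / 6) ^+ m)%R.
  have t01 : (0 <= q / 6 <= 1)%R by apply/andP; split; lra.
  have := bernoulli_upper m t01.
  have mq : (12^-1 <= m%:R * (q / 6))%R by rewrite -natr1 in qm; lra.
  have u0 : (0 <= (1 - q / 6) ^+ m)%R by rewrite exprn_ge0//; lra.
  have : ((1 - q / 6) ^+ m * (1 + 12^-1) <=
      (1 - q / 6) ^+ m * (1 + m%:R * (q / 6)))%R.
    by rewrite ler_wpM2l// lerD2l.
  by lra.
have safe : (2^-1 <= (1 - (g ^+ 2)^-1) ^+ m ^+ r)%R.
  rewrite -exprM; have g2 : (1 <= g ^+ 2)%R by apply: exprn_ege1.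
  have g20 : (0 < g ^+ 2)%R by lra.
  have s01 : (0 <= (g ^+ 2)^-1 <= 1)%R by rewrite invr_ge0 invf_le1// g2 ltW.
  apply: le_trans (bernoulli_lower (m * r) s01).
  have : ((m * r)%:R / g ^+ 2 <= 2^-1)%R.
    rewrite ler_pdivrMr//; apply: (@le_trans _ _ (2^-1 * g)%R); last first.
      by rewrite ler_wpM2l// expr2 ler_peMr// (le_trans _ g1).
    rewrite ler_pdivlMl// /gap -natrM ler_nat mulnA leq_mul2l.
    by apply/orP; right; exact: leqW (leqnSn r).
  by move: ((m * r)%:R / g ^+ 2)%R => t ?; lra.
have qc : (0 <= 1 - q)%R by lra.
have v_ge : ((1 - q) / 26 <= v)%R.
  have : ((1 - q) * 2^-1 <= (1 - q) * (1 - (g ^+ 2)^-1) ^+ m ^+ r)%R.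
    by rewrite ler_wpM2l.
  move=> h; apply: (@le_trans _ _ (13^-1 * ((1 - q) * 2^-1))%R); first by lra.
  by apply: ler_pM => //; rewrite mulr_ge0.
have v0 : (0 <= v)%R by apply: le_trans v_ge; lra.
apply: (@le_trans _ _ (v / 2)%R).
  apply: (@le_trans _ _ ((1 - q) / 26 / 2)%R); last by lra.
  have := lnln_sqr_le R m_gt0; set L := (ln (ln m%:R) ^+ 2)%R => Lm.
  have qL : (q * L <= 4)%R.
    apply: (@le_trans _ _ (q * (4 * m.+1%:R))%R); first by rewrite ler_wpM2l// ltW.
    by rewrite mulrCA qm mulr1.
  have : ((1 - q) * (q * L) <= (1 - q) * 4)%R by rewrite ler_wpM2l.
  by lra.
apply: (rsample_uniform_ge q01) => //.
  by move=> x; apply: rcost_after_ge0 => // Y h h0; apply: rgreedy_ge0.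
move=> i i1; split; first exact: far_ge.
by rewrite side_eq_main ?far_ge//; apply: contraTneq i1 => ->.
Qed.

End LineCosts.

Theorem theorem3 (R : realType) :
  exists (C : R -> R) (c : R), (0 < c)%R /\
  forall f : nat -> nat, (forall n, (0 < f n)%N) ->
  exists k0 : nat, forall k : nat, (k0 <= k)%N ->
  exists (d : nat) (mu : 'I_k -> probability (euclid R d) R),
    [/\ finite_moments mu,
        0 < reference_cost mu < +oo,
        forall alpha : R, (2 < alpha)%R ->
          Dalpha_cost mu alpha <= (C alpha)%:E * reference_cost mu &
        (c * ln (ln (f k)%:R) ^+ 2)%:E * reference_cost mu
          <= greedy_cost mu (f k)].
Proof.
exists (fun p => 6 * (1 + ((1 - 2 `^ (2 - p)) ^+ 2)^-1))%R, 208^-1%R.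
split=> [|f f_gt0]; first by rewrite invr_gt0.
(* From [k >= 4] on, [k = r.+2] with [r >= 2], so at least half of the clusters are far. This
   threshold does not depend on [f]. *)
exists 4%N => -[|[|r]]// r2; exists 1%N, (@line_clusters R r (f r.+2)).
have m_gt0 := f_gt0 r.+2.
have q0 := side_mass_gt0 R (f r.+2); have q2 := side_mass_le R m_gt0.
split.
- by apply: finite_moments_two_point; apply/andP; split; lra.
- rewrite line_reference_cost// ltry andbT lte_fin mulr_gt0//.
  by rewrite subr_gt0; lra.
- by move=> alpha a2; apply: line_Dalpha_cost.
- exact: line_greedy_cost.
Qed.
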